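(* Let $(K,v)$ be a valued field of rank 1, let $(K(x)|K,v)$ be an immediate extension such that $x\notin K^c$ and $\mathrm{appr}(x,K)$ is transcendental, and let $y\in K(x)^h$ be transcendental over $K$. Then $$[K(x)^h:K(y)^h]\;\leq\;\mathbf h_K(x:y).$$
   Context: Valuations are Krull valuations written additively; $vK$ is the value group and $Kv$ the residue field of $(K,v)$. Rank 1 means that $vK$ is nontrivial and archimedean. An extension $(L|K,v)$ is immediate if $vL=vK$ and $Lv=Kv$. An extension of $v$ to the algebraic closure of $K(x)$ is fixed; $E^h$ denotes the henselization, inside it, of an intermediate field $E$. $K^c$ denotes the completion of $(K,v)$; for $x$ in an immediate extension, $x\notin K^c$ means that there is $\gamma\in vK$ with $v(x-c)<\gamma$ for all $c\in K$. For $\alpha\in vK\cup\{\infty\}$ put $\mathrm{appr}(x,K)_\alpha=\{c\in K\mid v(x-c)\geq\alpha\}$. The approximation type of $x$ over $K$ is $\mathrm{appr}(x,K)=\{\mathrm{appr}(x,K)_\alpha\mid \alpha\in S\}$, where $S$, called its support, is the set of all $\alpha\in vK\cup\{\infty\}$ with $\mathrm{appr}(x,K)_\alpha\neq\emptyset$. It is immediate if $\bigcap_{\alpha\in S}\mathrm{appr}(x,K)_\alpha=\emptyset$. ''$\varphi(c)$ for $c\nearrow x$'' means: there is $\alpha\in vK$ with $\mathrm{appr}(x,K)_\alpha\ne\emptyset$ such that $\varphi(c)$ holds for all $c\in\mathrm{appr}(x,K)_\alpha$. $\mathrm{appr}(x,K)$ fixes the value of $g\in K[X]$ if there is $\alpha\in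 vK\cup\{\infty\}$ with $vg(c)=\alpha$ for $c\nearrow x$. An immediate $\mathrm{appr}(x,K)$ is transcendental if it fixes the value of every polynomial in $K[X]$. For nonconstant $f=\sum_j c_jX^j\in K[X]$ of degree $n$, let $f_i(X)=\sum_{j=i}^n\binom{j}{i}c_jX^{j-i}$ and, for $1\le i\le n$, let $\beta_i$ be the fixed value $vf_i(c)$ for $c\nearrow x$ ($\beta_i=\infty$ if $f_i=0$). $\mathbf h_K(x:f)$ is the unique integer $\mathbf h$ with $1\le \mathbf h\le n$ such that $\beta_{\mathbf h}+\mathbf h\, v(x-c)<\beta_i+i\, v(x-c)$ for all $i\neq\mathbf h$, $1\le i\le n$, for $c\nearrow x$ (it exists). $\mathrm{dist}(y,K)$ is the cut in the divisible hull $\widetilde{vK}$ of $vK$ whose lower cut set is the smallest initial segment of $\widetilde{vK}$ containing the support of $\mathrm{appr}(y,K)$ without $\infty$. For a value $\alpha$, $\alpha\geq\mathrm{dist}(y,K)$ means that $\alpha\geq\beta$ for all $\beta$ in the lower cut set. In the setting of the claim there exists $f\in K[X]$ with $v(y-f(x))\geq\mathrm{dist}(y,K)$; such $f$ is nonconstant, and one sets $\mathbf h_K(x:y):=\mathbf h_K(x:f)$, which does not depend on the choice of such $f$. *)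

(* Defs.v *)
From HB Require Import structures.
From mathcomp Require Import all_boot all_order all_algebra.
From mathcomp Require Import boolp classical_sets.

Set Implicit Arguments.
Unset Strict Implicit.
Unset Printing Implicit Defensive.

Import Order.TTheory GRing.Theory.

Local Open Scope classical_set_scope.
Local Open Scope ring_scope.

(* Totality is part of the mixin, rather than inherited from Order.Total,
   because HB only provides a join of Order.Total and GRing.Zmodule for
   number domains. *)
HB.mixin Record isOrderedGroup G of Num.POrderedZmodule G := {
  oag_total : total (<=%R : rel G);
  oag_leD2l : forall c a b : G, a <= b -> c + a <= c + b
}.

#[short(type="oagType")]
HB.structure Definition OrderedAbelianGroup :=
  { G of isOrderedGroup G & Num.POrderedZmodule G }.

Variant with_top (G : Type) := Fin of G | Infty.
Arguments Infty {G}.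

Definition option_of_with_top G (a : with_top G) : option G :=
  if a is Fin g then Some g else None.

Definition with_top_of_option G (a : option G) : with_top G :=
  if a is Some g then Fin g else Infty.

Fact option_of_with_topK G :
  cancel (@option_of_with_top G) (@with_top_of_option G).
Proof. by case. Qed.

HB.instance Definition _ (G : choiceType) :=
  Choice.copy (with_top G) (can_type (@option_of_with_topK G)).

Section WithTop.
Variable G : oagType.
Implicit Types a b c : with_top G.

Definition top_le a b :=
  match a, b with
  | _, Infty => true
  | Infty, Fin _ => false
  | Fin a, Fin b => a <= b
  end.

Definition top_add a b : with_top G :=
  if (a, b) is (Fin a, Fin b) then Fin (a + b) else Infty.

Fact top_le_anti : antisymmetric top_le.
Proof. by case=> [a|] [b|] //= /le_anti ->. Qed.

Fact top_le_trans : transitive top_le.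
Proof. by case=> [a|] [b|] [c|] //=; apply: le_trans. Qed.

Fact top_le_total : total top_le.
Proof. by case=> [a|] [b|] //=; apply: oag_total. Qed.

Fact top_addA : associative top_add.
Proof. by case=> [a|] [b|] [c|] //; congr Fin; apply: addrA. Qed.

Fact top_addC : commutative top_add.
Proof. by case=> [a|] [b|] //; congr Fin; apply: addrC. Qed.

Fact top_add0 : left_id (Fin 0) top_add.
Proof. by case=> [a|] //; congr Fin; apply: add0r. Qed.

HB.instance Definition _ := Order.isOrder.Build ring_display (with_top G)
  (fun _ _ => erefl) (fun _ _ => erefl) (fun _ _ => erefl)
  top_le_anti top_le_trans top_le_total.

HB.instance Definition _ := GRing.isNmodule.Build (with_top G)
  top_addA top_addC top_add0.

End WithTop.

Record valuation (F : fieldType) (G : oagType) := Valuation {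
  valuation_fun :> F -> with_top G;
  valuation_eqInfty : forall a, valuation_fun a = Infty <-> a = 0;
  valuationM :
    forall a b, valuation_fun (a * b) = valuation_fun a + valuation_fun b;
  valuationD :
    forall a b,
      Order.min (valuation_fun a) (valuation_fun b) <= valuation_fun (a + b)
}.

Section Subfields.
Variables (F : fieldType) (G : oagType) (v : valuation F G).
Implicit Types E L : set F.

Definition subfield L := divring_closed (mem L).

Definition algebraic_over E (z : F) :=
  exists p : {poly F}, [/\ p != 0, forall i, E p`_i & root p z].

Definition adjoin E (z : F) : set F := smallest subfield (E `|` [set z]).

Definition has_degree L E (d : nat) :=
  E `<=` L /\
  exists b : 'I_d -> F,
    [/\ forall i, L (b i),
        forall z, L z -> exists2 a : 'I_d -> F,
          forall i, E (a i) & z = \sum_i a i * b i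
      & forall a : 'I_d -> F, (forall i, E (a i)) ->
          \sum_i a i * b i = 0 -> forall i, a i = 0].

Definition value_group E : set G :=
  [set gamma | exists2 a, E a & v a = Fin gamma].

(* The residue class of an integral element, as a coset of the maximal ideal
   of F: the residue field of a subfield is thus a subset of that of F. *)
Definition residue_class (a : F) : set F := [set b | Fin 0 < v (b - a)].

Definition residue_field E : set (set F) :=
  [set residue_class a | a in [set a | E a /\ Fin 0 <= v a]].

Definition immediate_ext E L :=
  [/\ E `<=` L, value_group L = value_group E
    & residue_field L = residue_field E].

Definition rank1 E :=
  (exists2 gamma, value_group E gamma & gamma != 0) /\
  (forall gamma delta, value_group E gamma -> value_group E delta ->
    0 < gamma -> exists n, delta <= gamma *+ n).

Definition henselian L :=
  subfield L /\
  forall (p : {poly F}) (a : F),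
    (forall i, L p`_i /\ Fin 0 <= v p`_i) -> L a -> Fin 0 <= v a ->
    Fin 0 < v p.[a] -> v p^`().[a] = Fin 0 ->
    exists b, [/\ L b, root p b & Fin 0 < v (b - a)].

(* With F an algebraic closure of E, the intersection of all henselian
   subfields containing E is itself henselian (the root in Hensel's Lemma is
   unique) and is the henselization of E inside F. *)
Definition henselization E : set F := smallest henselian E.

End Subfields.

Section ApproximationTypes.
Variables (K F : fieldType) (G : oagType) (iota : {rmorphism K -> F}).
Variable v : valuation F G.
Implicit Types (x y : F) (f : {poly K}) (gamma : G) (a : with_top G).

Local Notation vK := (value_group v (range iota)).
Local Notation vKtop := ([set Fin gamma | gamma in vK] `|` [set Infty]).

Definition notin_completion x :=
  exists2 gamma, vK gamma & forall c : K, v (x - iota c) < Fin gamma.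

Definition appr x a : set K := [set c | a <= v (x - iota c)].

Definition appr_support x : set (with_top G) :=
  [set a | vKtop a /\ appr x a !=set0].

Definition immediate_appr x := \bigcap_(a in appr_support x) appr x a = set0.

Definition tends_to x (phi : K -> Prop) :=
  exists gamma, [/\ vK gamma, appr x (Fin gamma) !=set0
                  & forall c, appr x (Fin gamma) c -> phi c].

Definition fixed_value x f a :=
  vKtop a /\ tends_to x (fun c => v (iota f.[c]) = a).

Definition transcendental_appr x :=
  immediate_appr x /\ forall f, exists a, fixed_value x f a.

(* f^`N(i) is the polynomial sum_{j >= i} binom(j,i) c_j X^(j-i). *)
Definition is_rel_approx_degree x f (h : nat) :=
  exists beta : nat -> with_top G,
  let n := (size f).-1 in
  [/\ forall i, (1 <= i <= n)%N -> fixed_value x f^`N(i) (beta i),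
      (1 <= h <= n)%N
    & tends_to x (fun c => forall i, (1 <= i <= n)%N -> i != h ->
        (beta h + v (x - iota c) *+ h : with_top G)
          < beta i + v (x - iota c) *+ i)].

(* This is 0 when no such integer exists, e.g. when f is constant. *)
Definition rel_approx_degree_poly x f : nat :=
  xget 0%N [set h | is_rel_approx_degree x f h].

Definition divisible_hull : set G :=
  [set gamma | exists2 n, (0 < n)%N & vK (gamma *+ n)].

Definition initial_segment (J : set G) :=
  J `<=` divisible_hull /\
  forall gamma delta,
    J gamma -> divisible_hull delta -> delta <= gamma -> J delta.

Definition dist_lower y : set G :=
  smallest initial_segment [set gamma | appr_support y (Fin gamma)].

Definition ge_dist a y :=
  forall gamma, dist_lower y gamma -> Fin gamma <= a.

(* The polynomial f is chosen arbitrarily among those with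
   v (y - f(x)) >= dist(y,K). *)
Definition rel_approx_degree x y : nat :=
  rel_approx_degree_poly x
    (xget 0 [set f | ge_dist (v (y - (map_poly iota f).[x])) y]).

End ApproximationTypes.

(* Main.v *)
(* Write E = K(y)^h and let M be the minimal polynomial of x over E, so that
   K(x)^h = E(x) has degree deg M over E. Write M = R(X^q) with R separable and
   q a power of the characteristic exponent; comparing degrees, y already lies
   in K(x^q)^h. By rank 1, K[x^q] is dense in K(x^q)^h, so y is as close as we
   like to some f(x) with f = g(X^q), and f has the same h = h_K(x:f) and the
   same value of f_h(x) for all such f. Let x_1, ..., x_m be the distinct roots
   of M, so deg M = m q. As E is henselian, f - y takes the same value at every
   x_i as at x, hence is tiny there, and v(x_i - c) = v(x - c) for c in K. So
   f - y has a root z_i much closer to x_i than to the other x_j, and its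
   multiplicity is at least q because f - y is a polynomial in X^q. These m q
   roots lie in the ball of radius v(x - c) about x, which by the Newton polygon
   contains at most h roots of f - y as soon as c is close to x. *)

Require Import Defs.
From HB Require Import structures.
From mathcomp Require Import mpoly.
From mathcomp Require Import all_boot all_order all_algebra fingroup perm ring.
From mathcomp Require Import boolp classical_sets.

Set Implicit Arguments.
Unset Strict Implicit.
Unset Printing Implicit Defensive.

Import Order.TTheory GRing.Theory.

Local Open Scope classical_set_scope.
Local Open Scope ring_scope.

(** Three facts behind the overview need work. [henselian] only speaks of roots of polynomials over
    a subfield, so equality of the values of conjugates has to be derived: Hensel's lemma, applied
    to a polynomial built from products of roots, shows that the roots of least value form a factor
    over the subfield. This also makes algebraic extensions of henselian fields henselian, whence
    K(x)^h = E(x). Density of K[x^q] comes from its closure in [Omega]: rank 1 makes the closure a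
    field and lets Newton's iteration reach any precision, so the closure is henselian and contains
    K(x^q)^h. Finally, a polynomial f with v(y - f(x)) >= dist(y,K) exists because y is not in K^c:
    otherwise E would lie in the closure of K, and M would be a monic polynomial over that closure
    with root x, against the transcendence of the approximation type and the bound on v(x - c).
    Values are mostly compared as [v] of products in the field, with [v 1] for the value 0, so that
    multiplication replaces arithmetic with [Infty]. *)

Lemma oag_leD (G : oagType) (a b c d : G) : a <= b -> c <= d -> a + c <= b + d.
Proof.
move=> ab cd; apply: le_trans (oag_leD2l _ _ _ cd) _.
by rewrite ![_ + d]addrC; apply: oag_leD2l.
Qed.

(** * Valuations and Newton polygons *)

Section ValuationTheory.
Variables (F : fieldType) (G : oagType) (v : valuation F G).
Implicit Types (a c : F) (g : with_top G).

Lemma valuation0 : v 0 = Infty.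
Proof. exact/valuation_eqInfty. Qed.

Lemma val_fin a : a != 0 -> exists x, v a = Fin x.
Proof.
move=> a0; case E : (v a) => [x|]; first by exists x.
by move/valuation_eqInfty: E a0 => ->; rewrite eqxx.
Qed.

Lemma valuation1 : v 1 = Fin 0.
Proof.
have [x vx] := val_fin (oner_neq0 F).
have := valuationM v 1 1; rewrite mulr1 vx => -[].
by move=> /(congr1 (fun z => z - x)); rewrite addrK subrr => <-.
Qed.

Lemma le_val0 a : v a <= v 0.
Proof. by rewrite valuation0; case: (v a). Qed.

Lemma val_lt0 a : (v a < v 0) = (a != 0).
Proof.
rewrite valuation0; have [->|a0] := eqVneq a 0; first by rewrite valuation0 ltxx.
by have [x ->] := val_fin a0.
Qed.

Lemma val_neq0 a g : v a < g -> a != 0.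
Proof. by apply: contraTneq => ->; rewrite valuation0 -leNgt; case: g. Qed.

Lemma le_valM a (b : F) c d : v a <= v b -> v c <= v d -> v (a * c) <= v (b * d).
Proof.
rewrite !valuationM; case: (v b) (v a) (v d) (v c) => [?|] [?|] [?|] [?|] //.
exact: oag_leD.
Qed.

Lemma le_valM2l c a (b : F) : v a <= v b -> v (c * a) <= v (c * b).
Proof. exact: le_valM. Qed.

Lemma le_valM2r c a (b : F) : v a <= v b -> v (a * c) <= v (b * c).
Proof. by move=> ?; apply: le_valM. Qed.

Lemma le_val_pM2l c a (b : F) : c != 0 -> (v (c * a) <= v (c * b)) = (v a <= v b).
Proof.
move=> c0; apply/idP/idP; last exact: le_valM2l.
by move/(le_valM2l c^-1); rewrite !mulKf.
Qed.

Lemma le_val_pM2r c a (b : F) : c != 0 -> (v (a * c) <= v (b * c)) = (v a <= v b).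
Proof. by rewrite ![_ * c]mulrC; apply: le_val_pM2l. Qed.

Lemma lt_val_pM2l c a (b : F) : c != 0 -> (v (c * a) < v (c * b)) = (v a < v b).
Proof. by move=> c0; rewrite !ltNge le_val_pM2l. Qed.

Lemma lt_val_pM2r c a (b : F) : c != 0 -> (v (a * c) < v (b * c)) = (v a < v b).
Proof. by move=> c0; rewrite !ltNge le_val_pM2r. Qed.

Lemma val_pmulI c a (b : F) : c != 0 -> v (c * a) = v (c * b) -> v a = v b.
Proof.
move=> c0 E; apply/le_anti.
by rewrite -(le_val_pM2l a b c0) -(le_val_pM2l b a c0) E lexx.
Qed.

Lemma val_divE a (b : F) : a != 0 -> v a = v b -> v (b / a) = v 1.
Proof.
move=> a0 vab; have b0 : b != 0 by rewrite -val_lt0 -vab val_lt0.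
by rewrite valuationM -vab -valuationM divff.
Qed.

Lemma le_valX a (b : F) n : v a <= v b -> v (a ^+ n) <= v (b ^+ n).
Proof. by move=> vab; elim: n => // n IH; rewrite !exprS; apply: le_valM. Qed.

Lemma lt_valX a (b : F) n : (0 < n)%N -> v a < v b -> v (a ^+ n) < v (b ^+ n).
Proof.
move=> + vab; case: n => // n _; rewrite !exprS.
have a0 := val_neq0 vab.
have [->|b0] := eqVneq b 0; first by rewrite mul0r val_lt0 mulf_neq0 ?expf_neq0.
apply: le_lt_trans (_ : v (a * b ^+ n) < _); first exact/le_valM2l/le_valX/ltW.
by rewrite lt_val_pM2r // expf_neq0.
Qed.

Lemma le_val1X a n : v 1 <= v a -> v 1 <= v (a ^+ n).
Proof. by move/(le_valX n); rewrite expr1n. Qed.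

Lemma le_val1M a (b : F) : v 1 <= v a -> v 1 <= v b -> v 1 <= v (a * b).
Proof. by move=> a1 b1; rewrite -[1]mulr1; apply: le_valM. Qed.

Lemma le_val_add g a (b : F) : g <= v a -> g <= v b -> g <= v (a + b).
Proof.
by move=> ga gb; apply: le_trans (valuationD v a b); rewrite le_min ga.
Qed.

Lemma lt_val_add g a (b : F) : g < v a -> g < v b -> g < v (a + b).
Proof.
by move=> ga gb; apply: lt_le_trans (valuationD v a b); rewrite lt_min ga.
Qed.

Lemma valN1 : v (- 1) = v 1.
Proof.
by case: (ltgtP (v (-1)) (v 1)) => // /(@lt_valX _ _ 2 isT);
  rewrite sqrrN ltxx.
Qed.

Lemma valN a : v (- a) = v a.
Proof. by rewrite -mulN1r valuationM valN1 -valuationM mul1r. Qed.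

Lemma valB a (b : F) : v (a - b) = v (b - a).
Proof. by rewrite -opprB valN. Qed.

Lemma le_val_sub g a (b : F) : g <= v a -> g <= v b -> g <= v (a - b).
Proof. by move=> ga gb; apply: le_val_add; rewrite ?valN. Qed.

Lemma lt_val_sub g a (b : F) : g < v a -> g < v b -> g < v (a - b).
Proof. by move=> ga gb; apply: lt_val_add; rewrite ?valN. Qed.

Lemma val_addl a (b : F) : v a < v b -> v (a + b) = v a.
Proof.
move=> ab; apply/le_anti; rewrite le_val_add ?(ltW ab) // andbT leNgt.
by apply/negP => /lt_val_sub/(_ ab); rewrite addrK ltxx.
Qed.

Lemma val_subl a (b : F) : v a < v b -> v (a - b) = v a.
Proof. by move=> ab; apply: val_addl; rewrite valN. Qed.

Lemma val_close a (b : F) : v a < v (a - b) -> v b = v a.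
Proof. by move=> /val_subl; rewrite opprB addrC subrK. Qed.

Lemma le_val_sum g (I : Type) (r : seq I) (P : pred I) (f : I -> F) :
  (forall i, P i -> g <= v (f i)) -> g <= v (\sum_(i <- r | P i) f i).
Proof.
by move=> H; elim/big_ind: _ => //; [rewrite valuation0; case: (g)|exact: le_val_add].
Qed.

Lemma lt_val_sum c (I : Type) (r : seq I) (P : pred I) (f : I -> F) :
  c != 0 -> (forall i, P i -> v c < v (f i)) ->
  v c < v (\sum_(i <- r | P i) f i).
Proof.
by move=> c0 H; elim/big_ind: _ => //; [rewrite val_lt0|exact: lt_val_add].
Qed.

Lemma eq_val_prod (I : Type) (r : seq I) (P : pred I) (f h : I -> F) :
  (forall i, P i -> v (f i) = v (h i)) ->
  v (\prod_(i <- r | P i) f i) = v (\prod_(i <- r | P i) h i).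
Proof.
by move=> H; elim/big_rec2: _ => // i y1 y2 Pi e; rewrite !valuationM e H.
Qed.

Section NewtonPolygon.
Implicit Types (p q : {poly F}) (rs : seq F) (h i : nat).

Lemma coef_XsubCM (t : F) p i :
  (('X - t%:P) * p)`_i = (if i is k.+1 then p`_k else 0) - t * p`_i.
Proof. by rewrite mulrBl coefB coefXM coefCM; case: i. Qed.

(** Each term of the elementary symmetric function in coefficient [h] lacks [h] roots of the full
    product, and [d ^+ h] has at least their value. Used contrapositively: a constant term of too
    large value forces a root of value above [v d]. *)
Lemma val_coef0_prod_XsubC rs d h : (forall t, t \in rs -> v t <= v d) ->
  v (\prod_(t <- rs) ('X - t%:P))`_0 <= v ((\prod_(t <- rs) ('X - t%:P))`_h * d ^+ h).
Proof.
elim: rs h => [|t rs IH] h Hrs.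
  rewrite big_nil !coef1; case: h => [|h]; first by rewrite mulr1.
  by rewrite mul0r le_val0.
have {}IH k := IH k (fun s sin => Hrs s (mem_behead (s := t :: rs) sin)).
have td : v t <= v d by apply: Hrs; rewrite mem_head.
rewrite big_cons !coef_XsubCM sub0r valN mulrBl.
apply: le_val_sub; last by rewrite -mulrA; apply/le_valM2l/IH.
case: h => [|h]; first by rewrite mul0r le_val0.
by rewrite exprS mulrCA; apply: le_valM.
Qed.

(** The right end of the horizontal side of the Newton polygon; over a field containing all roots,
    [b] is the number of roots of nonnegative value. *)
Definition last_min_coef p (b : nat) :=
  (forall i, v p`_b <= v p`_i) /\ (forall i, (b < i)%N -> v p`_b < v p`_i).

Lemma last_min_coef_ex p : p != 0 -> exists n : nat, last_min_coef p n.
Proof.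
move=> p0; have sp : (0 < size p)%N by rewrite size_poly_gt0.
pose i0 := Ordinal sp.
case: (Order.TotalTheory.arg_minP (fun i : 'I_(size p) => v p`_i)
  (i0 := i0) (P := xpredT)) => // m _ Hm.
have Hm' i : v p`_m <= v p`_i.
  have [lti|lei] := ltnP i (size p); first exact: (Hm (Ordinal lti)).
  by rewrite (nth_default 0 lei); exact: le_val0.
pose Q (b : nat) := v p`_b <= v p`_m.
have Qlt b : Q b -> (b <= size p)%N.
  rewrite /Q; apply: contraTT; rewrite -!ltNge -ltnNge => /ltnW lt.
  rewrite (nth_default 0 lt) val_lt0; apply/eqP => pm.
  have := Hm' (size p).-1; rewrite pm leNgt val_lt0 -/(lead_coef p).
  by rewrite lead_coef_eq0 p0.
have [b Qb bmax] := ex_maxnP (ex_intro Q (m : nat) (lexx _)) Qlt.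
exists b; split=> [i|i lti]; first exact: le_trans Qb (Hm' i).
apply: le_lt_trans Qb _; rewrite ltNge; apply/negP => /bmax.
by rewrite leqNgt lti.
Qed.

(** In coefficient [b.+1] of the product, the term from [q]_b[strictly dominates]t * q[_b.+1], so a
    root of nonnegative value moves the index by one. *)
Lemma last_min_coef_XsubCM t q (b : nat) : v 1 <= v t -> q != 0 ->
  last_min_coef q b -> last_min_coef (('X - t%:P) * q) b.+1.
Proof.
move=> t1 q0 [qle qlt].
have tq i : v q`_i <= v (t * q`_i).
  by rewrite -{1}[q`_i]mul1r; apply: le_valM2r.
have Eb : v (('X - t%:P) * q)`_b.+1 = v q`_b.
  rewrite coef_XsubCM val_subl //; exact: lt_le_trans (qlt _ _) (tq _).
split=> i; rewrite Eb coef_XsubCM.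
  apply: le_val_sub; last exact: le_trans (tq _).
  by case: i => [|i]; first exact: le_val0.
case: i => // i lti; apply: lt_val_sub; first exact: qlt.
by apply: lt_le_trans (tq _); apply: qlt; apply: ltnW.
Qed.

(** The last index of least value is at least [size rs], and it cannot exceed [h]. *)
Lemma size_le_dominant rs q h : q != 0 -> (forall t, t \in rs -> v 1 <= v t) ->
  let p := \prod_(t <- rs) ('X - t%:P) * q in
  (forall i, (h < i)%N -> v p`_h < v p`_i) -> (size rs <= h)%N.
Proof.
move=> q0 Hrs /= Hh; have [b Hb] := last_min_coef_ex q0.
suff [H1 H2] : last_min_coef (\prod_(t <- rs) ('X - t%:P) * q) (size rs + b).
  apply: leq_trans (leq_addr b _) _; rewrite leqNgt; apply/negP => /Hh.
  by rewrite ltNge H1.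
elim: rs Hrs {Hh} => [|t rs IH] Hrs; first by rewrite big_nil mul1r.
rewrite big_cons -mulrA; apply: last_min_coef_XsubCM.
- by apply: Hrs; rewrite mem_head.
- by rewrite mulf_neq0 // monic_neq0 // monic_prod_XsubC.
- by apply: IH => s sin; apply: Hrs; rewrite inE sin orbT.
Qed.

Lemma size_le_dominant_scaled rs q h (r : F) : r != 0 -> q != 0 ->
  (forall t, t \in rs -> v r <= v t) ->
  let p := \prod_(t <- rs) ('X - t%:P) * q in
  (forall i, (h < i)%N -> v (p`_h * r ^+ h) < v (p`_i * r ^+ i)) -> (size rs <= h)%N.
Proof.
move=> r0 q0 Hrs /= Hh.
have scaleE p i : (p \Po (r *: 'X))`_i = p`_i * r ^+ i.
  rewrite comp_polyE (eq_bigr (fun l : 'I_(size p) => (p`_l * r ^+ l) *: 'X^l)).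
    rewrite -(poly_def _ (fun l => p`_l * r ^+ l)) coef_poly.
    by case: ltnP => // le; rewrite nth_default ?mul0r.
  by move=> l _; rewrite exprZn scalerA.
(* The substitution of rX for X turns radius [r] into radius 1; the power of [r] collects the
   factors from rX - t = r (X - t/r). *)
pose q' := r ^+ size rs *: (q \Po (r *: 'X)).
have sX : size (r *: 'X : {poly F}) = 2 by rewrite size_scale // size_polyX.
rewrite -(size_map (fun t => t / r)); apply: (@size_le_dominant _ q').
- by rewrite scaler_eq0 expf_eq0 (negPf r0) andbF /= comp_poly2_eq0.
- move=> _ /mapP[t tin ->]; rewrite -(@le_val_pM2r r) // mul1r divfK //.
  exact: Hrs.
have -> : \prod_(t <- [seq t / r | t <- rs]) ('X - t%:P) * q' =
    (\prod_(t <- rs) ('X - t%:P) * q) \Po (r *: 'X).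
  rewrite comp_polyM /q' -scalerAr scalerAl; congr (_ * _).
  elim: rs {Hrs Hh q'} => [|t rs IH] /=.
    by rewrite !big_nil scale1r -[RHS]/(1%:P \Po _) comp_polyC.
  rewrite !big_cons comp_polyM -IH exprS -scalerA scalerAr scalerAl; congr (_ * _).
  rewrite comp_polyB comp_polyX comp_polyC scalerBr; congr (_ - _).
  by rewrite -mul_polyC -polyCM mulrC divfK.
by move=> i lti; rewrite !scaleE; apply: Hh.
Qed.

Definition integral_coefs p := forall i, v 1 <= v p`_i.

Lemma val1_nat n : v 1 <= v n%:R.
Proof.
elim: n => [|n IH]; first exact: le_val0.
by rewrite -natr1; apply: le_val_add.
Qed.

Lemma integral_coefs_horner p a : integral_coefs p -> v 1 <= v a -> v 1 <= v p.[a].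
Proof.
move=> Hp Ha; rewrite horner_coef; apply: le_val_sum => i _.
by apply: le_val1M; [exact: Hp|exact: le_val1X].
Qed.

Lemma integral_coefs_nderivn p n : integral_coefs p -> integral_coefs p^`N(n).
Proof.
move=> Hp i; rewrite coef_nderivn -mulr_natr; apply: le_val1M; first exact: Hp.
exact: val1_nat.
Qed.

Lemma taylor2 p (b t : F) : integral_coefs p -> v 1 <= v b -> v 1 <= v t ->
  v (t ^+ 2) <= v (p.[b + t] - p.[b] - p^`().[b] * t).
Proof.
move=> Hp Hb Ht.
(* Padding the Taylor sum by two zero terms allows the first two to be split off whatever the degree
   of [p]. *)
have Es : p.[b + t] = \sum_(i < (size p).+2) p^`N(i).[b] * t ^+ i.
  rewrite nderiv_taylor; last exact: mulrC.
  rewrite -!(big_mkord xpredT (fun i => p^`N(i).[b] * t ^+ i)).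
  rewrite [RHS](big_cat_nat (n := size p)) ?leqW //= [X in _ = _ + X]big_nat.
  rewrite [X in _ = _ + X]big1 ?addr0 // => i /andP[lti _].
  by rewrite nderivn_poly0 // horner0 mul0r.
rewrite Es 2!big_ord_recl nderivn0 nderivn1 expr0 mulr1 expr1.
set S := \sum_(i < _) _; set d := _ * t.
have -> : p.[b] + (d + S) - p.[b] - d = S.
  by rewrite [p.[b] + _]addrC addrK [d + S]addrC addrK.
apply: le_val_sum => i _; rewrite -[t ^+ 2]mulr1.
rewrite [in X in _ <= X]/= /bump /= !add1n.
rewrite (exprD t 2 i) [X in _ <= v X]mulrCA; apply: le_valM2l.
apply: le_val1M; last exact: le_val1X.
by apply: integral_coefs_horner => //; apply: integral_coefs_nderivn.
Qed.
End NewtonPolygon.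
End ValuationTheory.

(** * Subfields and minimal polynomials *)

Section SubfieldType.
Variables (F : fieldType) (E : set F) (subE : subfield E).

Let Epred : {pred F} := mem E.
HB.instance Definition _ := GRing.isDivringClosed.Build F Epred subE.

Record subfield_type := SubfieldElt
  { subfield_val :> F; subfield_valP : subfield_val \in Epred }.
HB.instance Definition _ := [isSub for subfield_val].
HB.instance Definition _ := [Choice of subfield_type by <:].
HB.instance Definition _ := [SubChoice_isSubComUnitRing of subfield_type by <:].
HB.instance Definition _ :=
  [SubComUnitRing_isSubIntegralDomain of subfield_type by <:].
HB.instance Definition _ := [SubIntegralDomain_isSubField of subfield_type by <:].

(** Gives a subfield, which is only a set, a polynomial ring of its own: below, it is replaced by a
    field [k] with an embedding [j]. *)
Lemma subfield_is_range :
  exists (k : fieldType) (j : {rmorphism k -> F}), E = range j.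
Proof.
exists subfield_type, (val : {rmorphism subfield_type -> F}).
apply/seteqP; split=> [z Ez|_ [z _ <-]]; last by have := subfield_valP z; rewrite inE.
have zE : z \in Epred by rewrite inE.
by exists (SubfieldElt zE).
Qed.

End SubfieldType.

Section SubfieldSets.
Variable F : fieldType.
Implicit Types (E L : set F) (z : F).

Lemma subfieldP L : subfield L <->
  [/\ L 1, forall a b, L a -> L b -> L (a - b)
     & forall a b, L a -> L b -> L (a / b)].
Proof.
have LE a : (a \in (mem L : {pred F})) = (a \in L) by [].
split=> [[L1 LB Ld]|[L1 LB Ld]]; split.
- exact/set_mem.
- by move=> a b /mem_set aL /mem_set bL; apply/set_mem; apply: LB.
- by move=> a b /mem_set aL /mem_set bL; apply/set_mem; apply: Ld.
- exact/mem_set.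
- by move=> a b /set_mem aL /set_mem bL; apply/mem_set; apply: LB.
- by move=> a b /set_mem aL /set_mem bL; apply/mem_set; apply: Ld.
Qed.

Lemma subfield_range (k : fieldType) (j : {rmorphism k -> F}) : subfield (range j).
Proof.
apply/subfieldP; split; first by exists 1; rewrite ?rmorph1.
  by move=> _ _ [a _ <-] [b _ <-]; exists (a - b); rewrite ?rmorphB.
by move=> _ _ [a _ <-] [b _ <-]; exists (a / b); rewrite ?fmorph_div.
Qed.

Lemma subfield_adjoin E z : subfield (adjoin E z).
Proof.
apply/subfieldP; split=> [L [/subfieldP[] //]|a b La Lb L [sL EL]|a b La Lb L [sL EL]];
  have /subfieldP[_ LB Ld] := sL; [apply: LB|apply: Ld];
  [exact: La|exact: Lb|exact: La|exact: Lb].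
Qed.

Lemma sub_adjoin E z : E `<=` adjoin E z.
Proof. by move=> a Ea; apply: sub_gen_smallest; left. Qed.

Lemma mem_adjoin E z : adjoin E z z.
Proof. by apply: sub_gen_smallest; right. Qed.

Lemma adjoin_sub E z L : subfield L -> E `<=` L -> L z -> adjoin E z `<=` L.
Proof. by move=> sL EL Lz; apply: smallest_sub => // a [/EL|->]. Qed.

Lemma subfield_horner L (p : {poly F}) z :
  subfield L -> (forall i, L p`_i) -> L z -> L p.[z].
Proof.
move=> /subfield_is_range[k [j ->]] Lp [a _ <-].
elim/poly_ind: p Lp => [|p c IH] Lp; first by exists 0; rewrite ?horner0 ?rmorph0.
have [b _ <-] : range j c by have := Lp 0; rewrite coefD coefMX coefC add0r.
rewrite !hornerE; have [|d _ <-] := IH; last by exists (d * a + b); rewrite ?rmorphD ?rmorphM.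
by move=> i; have := Lp i.+1; rewrite coefD coefMX coefC addr0.
Qed.

Lemma poly_range (k : fieldType) (j : {rmorphism k -> F}) (p : {poly F}) :
  (forall i, range j p`_i) -> exists q, p = map_poly j q.
Proof.
move=> Hp; have /choice[c Hc] : forall i, exists a, j a = p`_i.
  by move=> i; have [a _ <-] := Hp i; exists a.
exists (\poly_(i < size p) c i); apply/polyP => i.
rewrite coef_map coef_poly; case: ltnP => [_|lei]; first exact/esym/Hc.
by rewrite raddf0 nth_default.
Qed.
End SubfieldSets.

Section MinimalPolynomial.
Variables (k F : fieldType) (j : {rmorphism k -> F}).
Implicit Types (p q M : {poly k}) (z : F).
Local Notation "p ^j" := (map_poly j p) (at level 2, format "p ^j").

Definition is_minpoly M z :=
  [/\ M \is monic, root M^j z & forall p, root p^j z -> M %| p].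

Lemma minpoly_ex z : algebraicOver j z -> exists M, is_minpoly M z.
Proof.
move=> [p0 nz0 p0z].
pose P n := `[< exists p, [/\ p != 0, root p^j z & size p = n] >].
have exP : exists n, P n by exists (size p0); apply/asboolP; exists p0.
case: (ex_minnP exP) => n /asboolP[M [M0 Mz sM]] minM.
have lM : lead_coef M != 0 by rewrite lead_coef_eq0.
exists ((lead_coef M)^-1 *: M); split.
- by rewrite monicE lead_coefZ mulVf.
- by rewrite rootE map_polyZ hornerZ (rootP Mz) mulr0.
move=> p pz; rewrite dvdpZl ?invr_eq0 //; apply: contraT => npM.
have: P (size (p %% M)).
  apply/asboolP; exists (p %% M); split=> //.
  have := congr1 (fun q => (map_poly j q).[z]) (divp_eq p M).
  rewrite rmorphD rmorphM !hornerE (rootP Mz) mulr0 add0r (rootP pz).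
  by move=> e; rewrite rootE -e.
by move/minM; rewrite -sM leqNgt ltn_modp M0.
Qed.

Lemma is_minpoly_neq0 M z : is_minpoly M z -> M != 0.
Proof. by case=> /monic_neq0. Qed.

Lemma is_minpoly_size M z : is_minpoly M z -> (1 < size M)%N.
Proof.
move=> [mM Mz _]; have := root_size_gt1 _ Mz; rewrite size_map_poly; apply.
by rewrite map_poly_eq0 monic_neq0.
Qed.

(** Irreducibility of [M]: if [g] does not vanish at [z], then [M %/ g] does, and it has smaller
    degree unless [g] is constant. *)
Lemma is_minpoly_dvdp M z g : is_minpoly M z -> g %| M ->
  root g^j z || (size g == 1%N).
Proof.
move=> HM gM; have M0 := is_minpoly_neq0 HM; case: HM => _ Mz Mdiv.
have g0 : g != 0 by apply: contraNneq M0 => g0; rewrite -dvd0p -g0.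
have dM : M %/ g != 0 by apply: contraNneq M0 => e; rewrite -(divpK gM) e mul0r.
move: Mz; rewrite -{1}(divpK gM) rmorphM rootM => /orP[|-> //].
move/Mdiv/(dvdp_leq dM); rewrite size_divp //.
have := size_poly_gt0 g; rewrite g0; have := dvdp_leq M0 gM.
case: (size g) => [|[|n]] //; first by rewrite orbT.
by move=> lt _ /=; rewrite leqNgt ltn_subrL (leq_trans _ lt).
Qed.

(** The gcd of [M] and [p] has the root [z'], so it is not constant; by irreducibility it vanishes
    at [z] and is a multiple of [M]. *)
Lemma is_minpoly_root M z z' : is_minpoly M z -> root M^j z' -> is_minpoly M z'.
Proof.
move=> HM Mz'; case: (HM) => mM Mz Mdiv; split=> // p pz'.
have gz' : root (gcdp M p)^j z' by rewrite gcdp_map root_gcd Mz'.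
have g0 : gcdp M p != 0 by rewrite gcdp_eq0 (negPf (is_minpoly_neq0 HM)).
case/orP: (is_minpoly_dvdp HM (dvdp_gcdl M p)) => [Mg|s1].
  by apply: dvdp_trans (Mdiv _ Mg) _; rewrite dvdp_gcdr.
have := root_size_gt1 _ gz'; rewrite map_poly_eq0 size_map_poly => /(_ g0).
by rewrite (eqP s1).
Qed.

Lemma adjoin_algebraic z : algebraicOver j z ->
  adjoin (range j) z = [set w | exists p, w = p^j.[z]].
Proof.
move=> algz; apply/seteqP; split=> [|_ [p ->]]; last first.
  apply: (subfield_horner (subfield_adjoin _ _) _ (@mem_adjoin _ _ _)) => i.
  by apply: sub_gen_smallest; left; exists p`_i => //; rewrite coef_map.
have [M HM] := minpoly_ex algz; have M0 := is_minpoly_neq0 HM.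
apply: adjoin_sub.
- apply/subfieldP; split; first by exists 1; rewrite rmorph1 hornerC.
    by move=> _ _ [p ->] [q ->]; exists (p - q); rewrite rmorphB !hornerE.
  move=> _ _ [p ->] [q ->].
  have [q0|q0] := eqVneq q^j.[z] 0; first by exists 0; rewrite q0 invr0 mulr0 rmorph0 horner0.
  have cMq : coprimep M q.
    case/orP: (is_minpoly_dvdp HM (dvdp_gcdl M q)) => //.
    by rewrite gcdp_map root_gcd => /andP[_]; rewrite rootE (negPf q0).
  have /Bezout_eq1_coprimepP[[u w] /= /(congr1 (fun r => r^j.[z]))] := cMq.
  have [_ Mz _] := HM.
  rewrite rmorphD !rmorphM rmorph1 !hornerE (rootP Mz) mulr0 add0r => e.
  exists (p * w); rewrite rmorphM hornerM; apply: (canLR (mulfK q0)).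
  by rewrite -mulrA e mulr1.
- by move=> _ [a _ <-]; exists a%:P; rewrite map_polyC hornerC.
- by exists 'X; rewrite map_polyX hornerX.
Qed.

Lemma adjoin_frac z w : adjoin (range j) z w ->
  exists p q, q^j.[z] != 0 /\ w = p^j.[z] / q^j.[z].
Proof.
apply: (@adjoin_sub _ _ _ [set w | exists p q, q^j.[z] != 0 /\ w = p^j.[z] / q^j.[z]]).
- apply/subfieldP; split.
  + by exists 1, 1; rewrite rmorph1 hornerC divr1 oner_neq0.
  + move=> _ _ [p1 [q1 [n1 ->]]] [p2 [q2 [n2 ->]]].
    exists (p1 * q2 - p2 * q1), (q1 * q2).
    rewrite rmorphB !rmorphM !hornerE mulf_neq0 //; split=> //.
    by rewrite -mulNr addf_div // mulNr.
  + move=> _ _ [p1 [q1 [n1 ->]]] [p2 [q2 [n2 ->]]].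
    have [e|n] := eqVneq p2^j.[z] 0.
      exists 0, 1; rewrite e mul0r invr0 mulr0 rmorph0 horner0 mul0r.
      by rewrite rmorph1 hornerC oner_neq0.
    exists (p1 * q2), (q1 * p2); rewrite !rmorphM !hornerE mulf_neq0 //; split=> //.
    by rewrite invf_div mulf_div.
- by move=> _ [a _ <-]; exists a%:P, 1; rewrite rmorph1 map_polyC !hornerC divr1 oner_neq0.
- by exists 'X, 1; rewrite rmorph1 map_polyX hornerX hornerC divr1 oner_neq0.
Qed.

End MinimalPolynomial.

Lemma algebraic_trans (k1 k2 F : fieldType) (j1 : {rmorphism k1 -> F})
    (j2 : {rmorphism k2 -> F}) (z : F) :
  (forall c, algebraicOver j2 (j1 c)) -> algebraicOver j1 z -> algebraicOver j2 z.
Proof.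
move=> alg [p p0 pz]; apply/integral_algebraic.
apply: (integral_root (p := map_poly j1 p)) => //; first by rewrite map_poly_eq0.
move=> _ /(nthP 0)[i _ <-]; apply/integral_algebraic.
by rewrite coef_map; apply: alg.
Qed.

Lemma algebraicOver_range (k F : fieldType) (j : {rmorphism k -> F}) (E : set F) z :
  E = range j -> algebraic_over E z -> algebraicOver j z.
Proof.
move=> -> [p [p0 pE pz]]; have [q Eq] := poly_range pE.
by exists q; rewrite -?Eq //; move: p0; rewrite Eq map_poly_eq0.
Qed.

Section Exchange.
Variables (K k F : fieldType) (iota : {rmorphism K -> F}) (j : {rmorphism k -> F}).
Variables x y : F.
Local Notation "p ^iota" := (map_poly iota p) (at level 2, format "p ^iota").

Lemma common_denominator (c : nat -> F) n :
  (forall i, adjoin (range iota) x (c i)) ->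
  exists d, d^iota.[x] != 0 /\
    forall i, (i < n)%N -> exists a, c i * d^iota.[x] = a^iota.[x].
Proof.
move=> Hc; elim: n => [|n [d [d0 Hd]]].
  by exists 1; rewrite rmorph1 hornerC oner_neq0.
have [p [q [q0 cn]]] := adjoin_frac (Hc n).
exists (d * q); rewrite rmorphM hornerM mulf_neq0 //; split=> // i.
rewrite ltnS leq_eqVlt => /predU1P[->|/Hd[a ea]].
  exists (p * d); rewrite cn rmorphM hornerM [d^iota.[x] * _]mulrC mulrA.
  by rewrite divfK.
by exists (a * q); rewrite mulrA ea rmorphM hornerM.
Qed.

(** After clearing denominators, an equation of y over K(x) is a polynomial relation between x and y
    over K. Read by powers of x, it is an equation for x over K(y), nontrivial because y is
    transcendental over K. *)
Lemma algebraic_exchange :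
  range iota `<=` range j -> range j y -> ~ algebraicOver iota y ->
  algebraic_over (adjoin (range iota) x) y -> algebraicOver j x.
Proof.
move=> Kk [y' _ ey] ytr [p [p0 pK py]].
have [d [d0 Hd]] := common_denominator (size p) pK.
have /choice[a Ha] i : exists a, (i < size p)%N -> p`_i * d^iota.[x] = a^iota.[x].
  by case: ltnP => [/Hd[a ea]|_]; [exists a | exists 0].
have /choice[b Hb] c : exists e, j e = iota c.
  by have [e _ <-] : range j (iota c); [apply: Kk; exists c | exists e].
pose n := size p; pose N := \max_(i < n) size (a i).
(* [Q l], evaluated at y, is the coefficient of the l-th power of x in the cleared relation. *)
pose Q l := \poly_(i < n) (a i)`_l.
have sa i : (i < n)%N -> (size (a i) <= N)%N.
  by move=> lti; apply: (leq_bigmax (Ordinal lti)).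
have QE l : (Q l)^iota.[y] = \sum_(i < n) iota (a i)`_l * y ^+ i.
  rewrite (@horner_coef_wide _ n); last first.
    by rewrite size_map_poly size_poly.
  by apply: eq_bigr => i _; rewrite coef_map coef_poly ltn_ord.
have [l Ql] : exists l, Q l != 0.
  have sp : ((size p).-1 < n)%N by rewrite prednK // size_poly_gt0.
  have: a (size p).-1 != 0.
    apply: contraNneq p0 => a0; have := Ha _ sp; rewrite a0 rmorph0 horner0.
    by move/eqP; rewrite mulf_eq0 (negPf d0) orbF lead_coef_eq0.
  rewrite -lead_coef_eq0 => l0; pose l := (size (a (size p).-1)).-1; exists l.
  apply: contraNneq l0 => Q0; rewrite lead_coefE.
  by have := coef_poly n (fun i => (a i)`_l) (size p).-1;
    rewrite -/(Q l) sp Q0 coef0 => <-.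
have lN : (l < N)%N.
  rewrite ltnNge; apply: contra Ql => Nl; apply/eqP/polyP => i.
  rewrite coef_poly coef0; case: ifP => // lti.
  by rewrite nth_default // (leq_trans (sa _ lti)).
pose R := \poly_(l < N) (\sum_(i < n) b (a i)`_l * y' ^+ i).
have jR l' : (l' < N)%N -> j R`_l' = (Q l')^iota.[y].
  move=> lt; rewrite coef_poly lt rmorph_sum QE; apply: eq_bigr => i _.
  by rewrite rmorphM rmorphXn Hb ey.
exists R.
  apply/eqP => R0; apply: ytr.
  by exists (Q l) => //; rewrite rootE -jR // R0 coef0 rmorph0.
rewrite rootE (@horner_coef_wide _ N); last by rewrite size_map_poly size_poly.
rewrite (eq_bigr (fun l' : 'I_N =>
    \sum_(i < n) iota (a i)`_l' * y ^+ i * x ^+ l')); last first.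
  by move=> l' _; rewrite coef_map /= jR // QE mulr_suml.
rewrite exchange_big /=.
under eq_bigr => i _ do under eq_bigr => l' _ do rewrite mulrAC.
under eq_bigr => i _ do rewrite -mulr_suml.
rewrite (eq_bigr (fun i : 'I_n => p`_i * y ^+ i * d^iota.[x])).
  by rewrite -mulr_suml -horner_coef (rootP py) mul0r.
move=> i _; rewrite mulrAC Ha // (@horner_coef_wide _ N).
  by congr (_ * _); apply: eq_bigr => l' _; rewrite coef_map.
by rewrite size_map_poly sa.
Qed.
End Exchange.

(** If the derivative vanishes, the characteristic is a prime p and [M] is a polynomial in X^p of
    smaller degree; iterate. The Frobenius identity is stated for polynomials over [F] because it is
    applied to powers of X - z. *)
Lemma inseparable_decomposition (k F : fieldType) (j : {rmorphism k -> F})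
    (M : {poly k}) : (1 < size M)%N ->
  exists R q, [/\ (0 < q)%N, M = R \Po 'X^q, R^`() != 0
    & forall a b : {poly F}, (a - b) ^+ q = a ^+ q - b ^+ q].
Proof.
have [n] := ubnP (size M); elim: n M => // n IH M ltn sM.
have [M'0|M'] := eqVneq M^`() 0; last by exists M, 1%N; rewrite expr1 comp_polyXr.
have dM i : M`_i != 0 -> i%:R = 0 :> k.
  case: i => [|i] Mi //; apply/eqP.
  have /eqP : M`_i.+1 * i.+1%:R = 0 by rewrite mulr_natr -coef_deriv M'0 coef0.
  by rewrite mulf_eq0 (negPf Mi).
have lM : M`_(size M).-1 != 0 by rewrite -lead_coefE lead_coef_eq0 -size_poly_gt0 ltnW.
have m0 : (0 < (size M).-1)%N by rewrite -subn1 subn_gt0.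
have [p pk] : exists p, p \in [pchar k].
  by apply: (natf0_pchar m0); apply/eqP/dM.
have pp := pcharf_prime pk; have p0 := prime_gt0 pp.
pose M1 := \poly_(i < size M) M`_(i * p).
have EM : M = M1 \Po 'X^p.
  apply/polyP => i; rewrite coef_comp_poly_Xn // coef_poly.
  have [/dvdnP[c ->]|npi] := boolP (p %| i)%N.
    rewrite mulnK //; case: ltnP => // le; rewrite nth_default //.
    by apply: leq_trans le _; rewrite leq_pmulr.
  by apply: contraNeq npi => /dM/eqP; rewrite (dvdn_pcharf pk).
have sM1 : (1 < size M1 < size M)%N.
  have := sM; have := congr1 (fun r : {poly k} => (size r).-1) EM.
  rewrite size_comp_poly size_polyXn /= => e.
  have p1 := prime_gt1 pp.
  have := m0; rewrite e muln_gt0 p0 andbT.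
  case: (size M1) e => [|[|s]] //= e _ _; rewrite -[size M]prednK ?(ltnW sM) // e.
  by rewrite !ltnS ltn_Pmulr.
have [R [q [q0 EM1 R' Fq]]] := IH M1 (leq_trans (proj2 (andP sM1)) ltn) (proj1 (andP sM1)).
exists R, (q * p)%N; split=> //; first by rewrite muln_gt0 q0.
  rewrite {1}EM EM1 -comp_polyA; congr (_ \Po _).
  by rewrite comp_Xn_poly exprAC exprM.
move=> a b; rewrite mulnC !exprM; rewrite -Fq; congr (_ ^+ _).
have pF : [pchar {poly F}].-nat p by rewrite pnatE // pchar_lalg (fmorph_pchar j).
by rewrite exprDn_pchar // exprNn_pchar.
Qed.


Section PolynomialsOverASubfield.
Variables (k : fieldType) (F : closedFieldType) (j : {rmorphism k -> F}).
Local Notation "p ^j" := (map_poly j p) (at level 2, format "p ^j").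

(** [M] divides [p], so [b] is a simple root of [M]; being the only one, it makes [M] linear. *)
Lemma simple_root_fixed (M p : {poly k}) b :
  is_minpoly j M b -> root p^j b -> (p^`())^j.[b] != 0 ->
  (forall b', root M^j b' -> b' = b) -> range j b.
Proof.
move=> HM pb p'b Mb; case: (HM) => mM _ Mdiv.
have M'b : (M^`())^j.[b] != 0.
  apply: contraNneq p'b => M'b; rewrite -(divpK (Mdiv _ pb)) derivM.
  have [_ Mr _] := HM; have Mb0 := rootP Mr.
  by rewrite rmorphD !rmorphM !hornerE M'b Mb0 !mulr0 addr0.
have [rs Ers] := closed_field_poly_normal M^j.
rewrite lead_coef_map (monicP mM) rmorph1 scale1r in Ers.
have rsb : forall t, t \in rs -> t = b.
  by move=> t tin; apply: Mb; rewrite Ers root_prod_XsubC.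
case: rs Ers rsb => [|t1 [|t2 rs]] Ers rsb.
- have := is_minpoly_size HM; rewrite -(size_map_poly j) Ers big_nil size_poly1.
  by [].
- exists (- M`_0) => //; rewrite rmorphN -coef_map Ers big_seq1 coefB coefX coefC.
  by rewrite sub0r opprK (rsb t1) ?mem_head.
- case/eqP: M'b; rewrite -deriv_map Ers !big_cons.
  rewrite (rsb t1) ?mem_head // (rsb t2) ?inE ?eqxx ?orbT //.
  by rewrite derivM derivXsubC mul1r !hornerE subrr !mul0r addr0.
Qed.

(** Newton interpolation: the divided difference [Q1] at [e0] takes values in [range j] at the
    remaining points and has smaller degree. *)
Lemma interpolation_range n (Q : {poly F}) (s : seq F) :
  (size Q <= n)%N -> uniq s -> (n <= size s)%N ->
  (forall e, e \in s -> range j e /\ range j Q.[e]) -> exists q, Q = q^j.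
Proof.
elim: n Q s => [|n IH] Q s sQ.
  by move: sQ; rewrite leqn0 size_poly_eq0 => /eqP ->; exists 0; rewrite rmorph0.
case: s => [//|e0 s] /= /andP[e0s us] sn Hs.
have [[a _ Ea] [c _ Ec]] := Hs e0 (mem_head _ _).
have /factor_theorem[Q1 EQ1] : root (Q - (Q.[e0])%:P) e0.
  by rewrite rootE !hornerE subrr.
have EQ : Q = Q1 * ('X - e0%:P) + (Q.[e0])%:P by rewrite -EQ1 subrK.
have sQ1 : (size Q1 <= n)%N.
  have [->|Q10] := eqVneq Q1 0; first by rewrite size_poly0.
  rewrite -ltnS.
  have <- : size (Q1 * ('X - e0%:P)) = (size Q1).+1.
    by rewrite size_Mmonic ?monicXsubC // size_XsubC addn2.
  rewrite -EQ1; apply: leq_trans (size_polyD _ _) _; rewrite geq_max sQ.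
  by rewrite size_polyN (leq_trans (size_polyC_leq1 _)).
have [e ein|q Eq] := IH Q1 s sQ1 us sn.
  have [[b _ Eb] [d _ Ed]] := Hs e (mem_behead (s := e0 :: s) ein).
  split; first by exists b.
  have ne : e - e0 != 0 by rewrite subr_eq0; apply: contraNneq e0s => <-.
  exists ((d - c) / (b - a)) => //.
  rewrite fmorph_div !rmorphB Ea Eb Ec Ed; apply: (canLR (mulfK ne)).
  by have := congr1 (horner^~ e) EQ1; rewrite !hornerE.
exists (q * ('X - a%:P) + c%:P).
by rewrite EQ rmorphD rmorphM rmorphB /= map_polyX !map_polyC /= Ea Ec Eq.
Qed.

End PolynomialsOverASubfield.

(** * Henselian fields *)

Section SymmetricFunctionsOfRoots.
Variables (k F : fieldType) (j : {rmorphism k -> F}).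
Variables (n : nat) (ts : n.-tuple F).
Hypothesis ts_coef : forall i, range j (\prod_(t <- ts) ('X - t%:P))`_i.
Local Notation ev := (mmap intr (tnth ts) : {mpoly int[n]} -> F).

Lemma ev_mesym (i : nat) : (i <= n)%N -> range j (ev (mesym n int i)).
Proof.
move=> lei.
have [c _ Ec] := ts_coef (n - i).
have := mroots_coeff ts (Ordinal (lei : (i < n.+1)%N)) => /= E.
exists ((-1) ^+ i * c) => //.
rewrite rmorphM Ec E rmorphXn rmorphN1 mulrA -exprMn mulrNN mulr1 expr1n mul1r.
rewrite /mesym !raddf_sum /=; apply/eq_bigr => h _; rewrite !rmorph_prod /=.
by apply/eq_bigr => l _; rewrite mmapX mmap1U mevalXU.
Qed.

Lemma ev_symmetric (p : {mpoly int[n]}) : p \is mpoly.symmetric -> range j (ev p).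
Proof.
move=> /sym_fundamental[t [<- _]].
have /choice[c Hc] (i : 'I_n) : exists c, j c = ev (mesym n int i.+1).
  by have [c _ Ec] := ev_mesym (ltn_ord i); exists c.
exists (\sum_(m <- msupp t) (t@_m)%:~R * \prod_i c i ^+ m i) => //.
rewrite comp_mpolyEX !raddf_sum /=; apply: eq_bigr => m _.
rewrite rmorphM rmorph_int rmorph_prod /= mmapZ; congr (_ * _).
rewrite comp_mpolyX rmorph_prod; apply: eq_bigr => i _.
by rewrite !rmorphXn Hc tnth_mktuple.
Qed.

(** A permutation of the variables permutes the r-subsets, so the coefficients of the generic
    polynomial [W] are symmetric and hence polynomials in the coefficients of the given product.
    Integer coefficients let [W] specialize to any field. *)
Lemma subset_products_coef (r i : nat) :
  range j (\prod_(J : {set 'I_n} | #|J| == r)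
             ('X - (\prod_(l in J) tnth ts l)%:P))`_i.
Proof.
pose W : {poly {mpoly int[n]}} :=
  \prod_(J : {set 'I_n} | #|J| == r) ('X - (\prod_(l in J) 'X_l)%:P).
suff -> : \prod_(J : {set 'I_n} | #|J| == r) ('X - (\prod_(l in J) tnth ts l)%:P)
    = map_poly ev W.
  rewrite coef_map /=; apply: ev_symmetric; apply/issymP => s.
  rewrite -[msym s _](coef_map (msym s) W); suff -> : map_poly (msym s) W = W by [].
  rewrite /W rmorph_prod /=.
  rewrite [RHS](reindex_inj (h := fun J : {set 'I_n} => imset s (mem J))) /=; last first.
    exact: imset_inj perm_inj.
  apply: eq_big => J; first by rewrite card_imset //; exact: perm_inj.
  move=> _; rewrite rmorphB /= map_polyX map_polyC /= rmorph_prod /=.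
  rewrite big_imset /=; last by move=> ? ? _ _; exact: perm_inj.
  congr ('X - _%:P); apply: eq_bigr => l _.
  rewrite msymX; congr 'X_[_].
  apply/mnmP => i0; rewrite mnmE !mnm1E; congr (nat_of_bool _).
  by rewrite -(inj_eq (@perm_inj _ s)) permKV.
rewrite rmorph_prod; apply: eq_bigr => J _.
rewrite rmorphB /= map_polyX map_polyC /=; congr ('X - _%:P).
by rewrite rmorph_prod; apply: eq_bigr => l _; rewrite /= mmapX mmap1U.
Qed.
End SymmetricFunctionsOfRoots.


Lemma coef_comp_XaddC (F : fieldType) (p : {poly F}) a i :
  (p \Po ('X + a%:P))`_i = p^`N(i).[a].
Proof.
have -> : p \Po ('X + a%:P) = \sum_(l < size p) p^`N(l).[a] *: 'X^l.
  rewrite /comp_poly addrC nderiv_taylor; last exact: mulrC.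
  rewrite size_map_polyC; apply: eq_bigr => l _.
  by rewrite nderivn_map horner_map mul_polyC.
rewrite -(poly_def _ (fun l => p^`N(l).[a])) coef_poly; case: ltnP => // le.
by rewrite nderivn_poly0 // horner0.
Qed.

Section Henselian.
Variables (F : closedFieldType) (G : oagType) (v : valuation F G).
Implicit Types (p : {poly F}) (a b : F) (E L : set F).

(** Rank 1 expressed by elements: the powers of any element of positive value are cofinal. *)
Definition archimedean_val :=
  forall w u : F, v 1 < v w -> u != 0 -> exists n, v u <= v (w ^+ n).

(** If every root of p(X + a) had value at most 0, its constant term could not have larger value
    than its linear coefficient. So the root exists in [F], and henselianity of a subfield only asks
    that the root lie there. *)
Lemma closed_hensel_root p a : v 1 < v p.[a] -> v p^`().[a] = v 1 ->
  exists b, root p b /\ v 1 < v (b - a).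
Proof.
move=> pa p'a; pose P := p \Po ('X + a%:P).
have P0 : P`_0 = p.[a] by rewrite coef_comp_XaddC nderivn0.
have P1 : P`_1 = p^`().[a] by rewrite coef_comp_XaddC nderivn1.
have [rs Ers] := closed_field_poly_normal P.
have [t [tin t1]] : exists t, t \in rs /\ v 1 < v t.
  apply: contrapT => H; suff: v P`_0 <= v (P`_1 * 1 ^+ 1) by rewrite mulr1 P0 P1 p'a leNgt pa.
  rewrite Ers !coefZ -mulrA; apply: le_valM2l; apply: val_coef0_prod_XsubC => t tin.
  by rewrite leNgt; apply/negP => t1; apply: H; exists t.
exists (t + a); rewrite addrK; split=> //.
have Pt : root P t by rewrite Ers rootE hornerZ (rootP (_ : root _ t)) ?mulr0 ?root_prod_XsubC.
by move: Pt; rewrite /P !rootE horner_comp !hornerE.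
Qed.

Lemma integral_coefs_deriv p : integral_coefs v p -> integral_coefs v p^`().
Proof. by move=> Hp; rewrite -nderivn1; apply: integral_coefs_nderivn. Qed.

Lemma integral_coefs_lipschitz p a b :
  integral_coefs v p -> v 1 <= v a -> v 1 <= v b -> v (b - a) <= v (p.[b] - p.[a]).
Proof.
move=> Hp Ha Hb; have Hba : v 1 <= v (b - a) by apply: le_val_sub.
have := taylor2 Hp Ha Hba; rewrite [a + _]addrC subrK => H.
rewrite -[p.[b] - p.[a]](subrK (p^`().[a] * (b - a))); apply: le_val_add.
  by apply: le_trans H; rewrite -{1}[b - a]mul1r expr2; apply: le_valM2r.
rewrite -{1}[b - a]mul1r; apply: le_valM2r.
by apply: integral_coefs_horner => //; apply: integral_coefs_deriv.
Qed.

Lemma val_near1 a b : v 1 <= v a -> v 1 <= v (b - a) -> v 1 <= v b.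
Proof. by move=> a1 ba; rewrite -[b](subrK a); apply: le_val_add. Qed.

Lemma hensel_deriv p a b : integral_coefs v p -> v 1 <= v a -> v 1 < v (b - a) ->
  v p^`().[a] = v 1 -> v p^`().[b] = v 1.
Proof.
move=> Hp Ha Hb p'a; have Hb1 := val_near1 Ha (ltW Hb).
rewrite -p'a; apply: val_close; rewrite p'a valB.
by apply: lt_le_trans Hb _; apply: integral_coefs_lipschitz => //; apply: integral_coefs_deriv.
Qed.

(** For two such roots with nonzero difference t, Taylor expansion gives v(p'(b) t) >= 2 v(t),
    impossible when p'(b) is a unit and v(t) > 0. *)
Lemma hensel_root_unique p a b b' : integral_coefs v p -> v 1 <= v a ->
  v p^`().[a] = v 1 -> root p b -> root p b' ->
  v 1 < v (b - a) -> v 1 < v (b' - a) -> b = b'.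
Proof.
move=> Hp Ha p'a pb pb' Hb Hb'; apply/eqP; rewrite eq_sym -subr_eq0.
apply: contraT => t0; have Hb1 := val_near1 Ha (ltW Hb).
have Ht : v 1 < v (b' - b).
  have -> : b' - b = (b' - a) - (b - a) by ring.
  exact: lt_val_sub.
have := taylor2 Hp Hb1 (ltW Ht).
rewrite [b + _]addrC subrK (rootP pb) (rootP pb') subrr sub0r valN.
rewrite expr2 le_val_pM2r // => H; move: Ht; rewrite ltNge => /negP[].
by rewrite -(hensel_deriv Hp Ha Hb p'a).
Qed.

Lemma henselianP L : henselian v L <-> subfield L /\
  forall p a, integral_coefs v p -> (forall i, L p`_i) -> L a -> v 1 <= v a ->
    v 1 < v p.[a] -> v p^`().[a] = v 1 ->
    exists b, [/\ L b, root p b & v 1 < v (b - a)].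
Proof.
rewrite /henselian /integral_coefs !valuation1; split=> -[sL HL]; split=> // p a.
  by move=> Hp Lp; apply: HL => i; split.
by move=> Hp; apply: HL => i; have [] := Hp i.
Qed.

Lemma henselian_henselization E : henselian v (henselization v E).
Proof.
apply/henselianP; split.
  apply/subfieldP; split=> [L [/henselianP[/subfieldP[] //]]|a b La Lb L HL|a b La Lb L HL];
  have [/henselianP[/subfieldP[_ LB Ld] _] _] := HL; [apply: LB|apply: Ld];
  by [apply: La|apply: Lb].
move=> p a Hp Ep Ea a1 pa p'a.
have [b [pb ba]] := closed_hensel_root pa p'a.
exists b; split=> // L HL; have [/henselianP[_ HL'] _] := HL.
have [b' [Lb' pb' b'a]] := HL' p a Hp (fun i => Ep i L HL) (Ea L HL) a1 pa p'a.
by rewrite (hensel_root_unique Hp a1 p'a pb pb' ba b'a).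
Qed.

Lemma sub_henselization E : E `<=` henselization v E.
Proof. exact: sub_gen_smallest. Qed.

Lemma henselization_sub E L : henselian v L -> E `<=` L -> henselization v E `<=` L.
Proof. exact: smallest_sub. Qed.

Definition closed_val L :=
  forall z, (forall w, w != 0 -> exists2 a, L a & v w <= v (z - a)) -> L z.

(** Newton's iteration from [a] with the derivative frozen at [a] gains at least [v (b - a)] per
    step, so rank 1 gives every precision. No completeness is involved: the limit [b] already exists
    in [F]. *)
Lemma closed_subfield_henselian L : archimedean_val -> subfield L ->
  closed_val L -> henselian v L.
Proof.
move=> arch sL cL; apply/henselianP; split=> // p a Hp Lp La a1 pa p'a.
have [b [pb ba]] := closed_hensel_root pa p'a.
exists b; split=> //; apply: cL => w w0.
have b1 := val_near1 a1 (ltW ba).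
have [n Hn] := arch _ _ ba w0.
suff [c [Lc c1 bc]] : exists c, [/\ L c, v 1 <= v c & v ((b - a) ^+ n.+1) <= v (b - c)].
  exists c => //; apply: le_trans Hn _; apply: le_trans bc.
  by rewrite exprS -{1}[_ ^+ n]mul1r; apply: le_valM2r; apply: ltW.
have /subfieldP[L1 LB Ld] := sL.
elim: n {Hn} => [|n [c [Lc c1 bc]]]; first by exists a; rewrite expr1.
have p'a0 : p^`().[a] != 0 by rewrite -(val_lt0 v) p'a val_lt0 oner_neq0.
have ba0 : v 1 <= v (b - a) by exact: ltW.
have bc1 : v (b - a) <= v (b - c).
  by apply: le_trans bc; rewrite exprS -{1}[b - a]mulr1; apply/le_valM2l/le_val1X.
have cb1 : v 1 <= v (c - b) by rewrite valB; apply: le_trans bc1.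
exists (c - p.[c] / p^`().[a]).
have Lpc : L p.[c] by apply: subfield_horner.
have Lp'a : L p^`().[a].
  apply: subfield_horner => // i; rewrite coef_deriv.
  have [k [j EL]] := subfield_is_range sL.
  by have := Lp i.+1; rewrite EL => -[e _ <-]; exists (e *+ i.+1); rewrite ?rmorphMn.
(* Up to the unit p'(a), the new error is the quadratic Taylor remainder at [b] plus (p'(b) - p'(a))
   (c - b); both have one more factor of value at least [v (b - a)] than the old error. *)
have key : v ((b - a) ^+ n.+2) <= v (b - (c - p.[c] / p^`().[a])).
  have -> : b - (c - p.[c] / p^`().[a]) =
     (p.[c] - (c - b) * p^`().[a]) / p^`().[a].
    by field.
  have Vp : v (p^`().[a])^-1 = v 1 by rewrite -[_^-1]mul1r; apply: val_divE.
  rewrite [X in _ <= X]valuationM Vp -valuationM mulr1.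
  have := taylor2 Hp b1 cb1.
  rewrite (_ : b + (c - b) = c) ?(rootP pb) ?subr0; last by ring.
  move=> H; set r := p.[c] - _ in H.
  have -> : p.[c] - (c - b) * p^`().[a] = r + (p^`().[b] * (c - b) - (c - b) * p^`().[a]).
    by rewrite /r; ring.
  apply: le_val_add.
    apply: le_trans H; rewrite exprS expr2.
    by apply: le_valM; rewrite (valB v c).
  have -> : p^`().[b] * (c - b) - (c - b) * p^`().[a] =
    (p^`().[b] - p^`().[a]) * (c - b) by ring.
  rewrite exprS; apply: le_valM; last by rewrite (valB v c).
  by apply: integral_coefs_lipschitz => //; apply: integral_coefs_deriv.
split=> //; first by apply: LB => //; apply: Ld.
apply: (@val_near1 b) => //; rewrite valB; apply: le_trans key.
exact: le_val1X.
Qed.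
End Henselian.

(** * Equal values of conjugates over a henselian field *)

Section ConjugateValues.
Variables (k : fieldType) (F : closedFieldType) (j : {rmorphism k -> F}).
Variables (G : oagType) (v : valuation F G).
Hypothesis hensel : henselian v (range j).
Local Notation "p ^j" := (map_poly j p) (at level 2, format "p ^j").

Lemma integral_coefs_prod_XsubC (I : Type) (r : seq I) (P : pred I) (f : I -> F) :
  (forall i, P i -> v 1 <= v (f i)) ->
  integral_coefs v (\prod_(i <- r | P i) ('X - (f i)%:P)).
Proof.
move=> Hf; elim/big_ind: _ => [i|p q Hp Hq i|i Pi [|[|n]]].
- by rewrite coef1; case: eqP => _; [exact: lexx|exact: le_val0].
- by rewrite coefM; apply: le_val_sum => l _; apply: le_val1M.
- by rewrite coefB coefX coefC sub0r valN; apply: Hf.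
- by rewrite coefB coefX coefC subr0.
- by rewrite coefB coefX coefC subr0; exact: le_val0.
Qed.

Lemma scaled_prod_coef (I : finType) (P : pred I) (f : I -> F) s :
  s != 0 -> range j s ->
  (forall i, range j (\prod_(l | P l) ('X - (f l)%:P))`_i) ->
  forall i, range j (\prod_(l | P l) ('X - (f l / s)%:P))`_i.
Proof.
move=> s0 [s' _ Es] /poly_range[W' EW] i.
suff -> : \prod_(l | P l) ('X - (f l / s)%:P) =
    (s'^-1 ^+ #|P| *: (W' \Po (s' *: 'X)))^j.
  by exists (s'^-1 ^+ #|P| *: (W' \Po (s' *: 'X)))`_i; rewrite ?coef_map.
rewrite map_polyZ map_comp_poly map_polyZ map_polyX -EW rmorphXn fmorphV /= Es.
rewrite rmorph_prod /=.
rewrite [X in _ = _ *: X](eq_bigr (fun l => s *: ('X - (f l / s)%:P))); last first.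
  move=> l _; rewrite /= comp_polyB comp_polyX comp_polyC scalerBr; congr (_ - _).
  by rewrite -mul_polyC -polyCM mulrC divfK.
by rewrite scaler_prod prodr_const scalerA -exprMn mulVf // expr1n scale1r.
Qed.

(* If r of the roots have minimal value, their product w has strictly smaller
   value than the product of any other r roots. So w, divided by the sum s of
   all r-fold products, is the only root with residue 1 of a polynomial over
   [range j], and Hensel's lemma puts w / s in [range j]. *)
Lemma min_value_product (ts : seq F) t0 :
  (forall i, range j (\prod_(t <- ts) ('X - t%:P))`_i) ->
  t0 != 0 -> (forall t, t \in ts -> v t0 <= v t) ->
  range j (\prod_(t <- ts | v t == v t0) t).
Proof.
move=> Hts t00 minv.
pose tt := in_tuple ts; pose f := tnth tt.
pose J0 := [set l | v (f l) == v t0]%SET.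
pose P (J : {set 'I_(size ts)}) := \prod_(l in J) f l.
have -> : \prod_(t <- ts | v t == v t0) t = P J0.
  rewrite (big_tnth _ _ ts) /P; apply: eq_bigl => l.
  by rewrite inE.
pose r := #|J0|.
have fmin l : v t0 <= v (f l) by apply: minv; apply: mem_tnth.
have f0 l : l \in J0 -> f l != 0 by rewrite inE -(val_lt0 v) => /eqP->; rewrite val_lt0.
have vP0 : v (P J0) = v (t0 ^+ r).
  rewrite /P /r -prodr_const; apply: eq_val_prod => l.
  by rewrite inE => /eqP.
have leP (J : {set 'I_(size ts)}) : v (t0 ^+ #|J|) <= v (P J).
  rewrite /P -prodr_const; elim/big_rec2: _ => // l a b _ H; exact: le_valM.
have ltP (J : {set 'I_(size ts)}) : #|J| = r -> J != J0 -> v (P J0) < v (P J).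
  move=> cJ nJ.
  have [l lJ lJ0] : exists2 l, l \in J & l \notin J0.
    apply/subsetPn; apply: contra nJ => sJ.
    by rewrite eqEcard sJ cJ leqnn.
  have tl : v t0 < v (f l) by rewrite lt_neqAle fmin andbT eq_sym; rewrite inE in lJ0.
  rewrite vP0 -cJ (cardsD1 l J) lJ exprS /P (big_setD1 l lJ) /=.
  apply: lt_le_trans (_ : v (f l * t0 ^+ #|J :\ l|) <= _).
    by rewrite lt_val_pM2r // expf_neq0.
  exact/le_valM2l/leP.
have Pc i : range j (\prod_(J : {set 'I_(size ts)} | #|J| == r) ('X - (P J)%:P))`_i.
  exact: (@subset_products_coef _ _ j _ tt Hts r i).
pose s := \sum_(J : {set 'I_(size ts)} | #|J| == r) P J.
have P00 : P J0 != 0 by rewrite /P; apply/prodf_neq0.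
have cJ0 : #|J0| == r by [].
have sJ0 : v (P J0) < v (s - P J0).
  rewrite /s (bigD1 J0) //= addrC addrK; apply: lt_val_sum => // J /andP[/eqP cJ nJ].
  exact: ltP.
have vs : v s = v (P J0) by apply: val_close; rewrite valB.
have s0 : s != 0 by rewrite -(val_lt0 v) vs val_lt0.
have sE : range j s.
  pose us := [seq P J | J <- enum [pred J : {set 'I_(size ts)} | #|J| == r]].
  have -> : s = - (\prod_(u <- us) ('X - u%:P))`_(size us).-1.
    rewrite coefPn_prod_XsubC ?opprK; first by rewrite big_map big_enum.
    rewrite size_map -cardE; apply/eqP => /card0_eq/(_ J0).
    by rewrite !inE cJ0.
  have -> : \prod_(u <- us) ('X - u%:P) =
      \prod_(J : {set 'I_(size ts)} | #|J| == r) ('X - (P J)%:P).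
    by rewrite big_map big_enum.
  by have [c _ <-] := Pc (size us).-1; exists (- c); rewrite ?rmorphN.
have uint (J : {set 'I_(size ts)}) : #|J| == r -> v 1 <= v (P J / s).
  move=> /eqP cJ; rewrite -(divff s0) valuationM [X in _ <= X]valuationM.
  rewrite -!valuationM; apply: le_valM2r; rewrite vs vP0 -cJ; exact: leP.
have v01 : v (P J0 / s) = v 1 by apply: val_divE.
have ugt (J : {set 'I_(size ts)}) : #|J| == r -> J != J0 -> v 1 < v (P J / s).
  move=> /eqP cJ nJ; rewrite -v01 lt_val_pM2r ?invr_eq0 //; exact: ltP.
pose p := \prod_(J : {set 'I_(size ts)} | #|J| == r) ('X - (P J / s)%:P).
have Ep : p = ('X - (P J0 / s)%:P) *
  \prod_(J : {set 'I_(size ts)} | (#|J| == r) && (J != J0)) ('X - (P J / s)%:P).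
  by rewrite /p (bigD1 J0).
(* All roots of [q] have residue 0, so [q] is a unit at 1 and 1 is a simple root of [p] modulo the
   maximal ideal. *)
set q := \prod_(J | _ && _) _ in Ep.
have q1 : v q.[1] = v 1.
  rewrite /q horner_prod (@eq_val_prod _ _ v _ _ _ _ (fun=> 1)) ?big1 // => J /andP[cJ nJ].
  by rewrite !hornerE val_subl //; apply: ugt.
have J01 : v 1 < v (1 - P J0 / s).
  rewrite -(divff s0) -mulrBl lt_val_pM2r ?invr_eq0 //.
  by rewrite vs.
have qint : integral_coefs v q.
  by apply: integral_coefs_prod_XsubC => J /andP[cJ _]; apply: uint.
have [b [Lb pb b1]] : exists b, [/\ range j b, root p b & v 1 < v (b - 1)].
  have [_ H] := (henselianP v (range j)).1 hensel; apply: H => //.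
  - exact: integral_coefs_prod_XsubC.
  - exact: scaled_prod_coef.
  - by exists 1; rewrite ?rmorph1.
  - rewrite Ep hornerM valuationM q1 -valuationM mulr1.
    by rewrite !hornerE.
  - rewrite Ep derivM derivXsubC mul1r hornerD val_addl // q1 hornerM hornerXsubC.
    apply: lt_le_trans J01 _; rewrite -{1}[1 - _]mulr1; apply: le_valM2l.
    by apply: integral_coefs_horner => //; apply: integral_coefs_deriv.
have [J cJ Eb] : exists2 J : {set 'I_(size ts)}, #|J| == r & b = P J / s.
  move: pb; rewrite /root horner_prod => /prodf_eq0[J cJ].
  by rewrite !hornerE subr_eq0 => /eqP; exists J.
(* The root from Hensel's lemma has residue 1, which excludes every subset other than [J0]. *)
have [EJ|nJ] := eqVneq J J0.
  have [c _ Ec] := Lb; have [d _ Ed] := sE; exists (c * d) => //.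
  by rewrite rmorphM Ec Ed Eb EJ divfK.
have := lt_val_sub (ugt J cJ nJ) b1; rewrite -Eb opprB addrC subrK.
by rewrite ltxx.
Qed.

Hypothesis arch : archimedean_val v.
Hypothesis val_nontrivial : exists2 w, range j w & w != 0 /\ v 1 < v w.
Hypothesis alg : forall z, algebraicOver j z.

Lemma seq_min_val (ts : seq F) t : t \in ts ->
  exists2 t0, t0 \in ts & forall u, u \in ts -> v t0 <= v u.
Proof.
elim: ts t => // a [|a1 ts] IH t _.
  by exists a; rewrite ?mem_head // => u; rewrite inE => /eqP->.
have [t1 t1in Ht1] := IH a1 (mem_head _ _).
have [le|lt] := leP (v t1) (v a).
  exists t1 => [|u]; first by rewrite inE t1in orbT.
  by rewrite inE => /predU1P[->//|]; apply: Ht1.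
exists a => [|u]; first exact: mem_head.
by rewrite inE => /predU1P[->//|/Ht1]; apply: le_trans; apply: ltW.
Qed.

(* [min_value_product] applied to the shifts [t - e], with [e] in [range j] of
   large value, gives the values of this factor at enough points [e]. *)
Lemma min_value_factor (ts : seq F) t0 : t0 \in ts ->
  (forall i, range j (\prod_(t <- ts) ('X - t%:P))`_i) ->
  (forall t, t \in ts -> v t0 <= v t) ->
  exists A, A^j = \prod_(t <- ts | v t == v t0) ('X - t%:P).
Proof.
move=> t0in Hts minv; have [t00|t00] := eqVneq t0 0.
  (* If the least value is [Infty], every root is 0 and the factor is the whole product. *)
  have [A EA] := poly_range Hts; exists A; rewrite -EA [RHS]big_seq_cond [LHS]big_seq_cond.
  apply: eq_bigl => t; case tin : (t \in ts) => //=.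
  by rewrite eq_le (minv _ tin) t00 le_val0.
have [w Ew [w0 w1]] := val_nontrivial.
have [N HN] := arch w1 t00.
(* The factor has size at most [n], so [n] distinct points determine it. Their values exceed [v t0],
   so shifting by them does not change which roots have least value. *)
pose n := (size ts).+1; pose e i := w ^+ (N.+1 + i).
have ve i : v t0 < v (e i).
  apply: le_lt_trans HN _; rewrite /e addSnnS exprD -{1}[w ^+ N]mulr1.
  by rewrite lt_val_pM2l ?expf_neq0 // -[1](expr1n _ i.+1) lt_valX.
have Ee i : range j (e i).
  by have [c _ Ec] := Ew; exists (c ^+ (N.+1 + i)); rewrite // rmorphXn Ec.
have [A ->] : exists A, \prod_(t <- ts | v t == v t0) ('X - t%:P) = A^j; last by exists A.
apply: (@interpolation_range _ _ j n _ (mkseq e n)).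
- rewrite -big_filter size_prod_XsubC size_filter; exact: count_size.
- apply/mkseq_uniqP => a b _ _; rewrite /e !exprD => /(mulfI (expf_neq0 N.+1 w0)).
  wlog ltab : a b / (a < b)%N.
    by case: (ltngtP a b) => // lt H ab; [|symmetry]; apply: H.
  move/(congr1 v); have := @lt_valX _ _ v 1 w (b - a) _ w1.
  rewrite subn_gt0 ltab expr1n => /(_ isT) lt.
  move=> eab; exfalso; move: lt; rewrite -(@lt_val_pM2l _ _ v (w ^+ a)) ?expf_neq0 //.
  by rewrite mulr1 -exprD subnKC ?(ltnW ltab) // eab ltxx.
- by rewrite size_mkseq.
move=> _ /mapP[i _ ->]; split=> //.
have Hte : forall l, range j (\prod_(t <- [seq t - e i | t <- ts]) ('X - t%:P))`_l.
  have [A EA] := poly_range Hts; have [c _ Ec] := Ee i => l.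
  have <- : (A \Po ('X + c%:P))^j = \prod_(t <- [seq t - e i | t <- ts]) ('X - t%:P).
    rewrite map_comp_poly -EA rmorphD /= map_polyX map_polyC /= Ec.
    rewrite rmorph_prod big_map; apply: eq_bigr => t _.
    by rewrite /= comp_polyB comp_polyX comp_polyC polyCB; ring.
  by rewrite coef_map; exists (A \Po ('X + c%:P))`_l.
have vt t : t \in ts -> (v (t - e i) == v (t0 - e i)) = (v t == v t0).
  move=> tin; rewrite (val_subl (ve i)).
  have := minv t tin; rewrite le_eqVlt => /predU1P[vt|vt].
    by rewrite val_subl -?vt ?eqxx.
  rewrite [in RHS]eq_sym [v t0 == _]lt_eqF // eq_sym lt_eqF //.
  exact: lt_val_sub.
have t0e : t0 - e i != 0 by rewrite -(val_lt0 v) (val_subl (ve i)) val_lt0.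
have [|c _ Ec] := min_value_product Hte t0e.
  move=> _ /mapP[t tin ->]; rewrite (val_subl (ve i)).
  by apply: le_val_sub; [apply: minv|apply: ltW].
exists ((-1) ^+ (count (fun t => v t == v t0) ts) * c) => //.
rewrite rmorphM rmorphXn rmorphN1 Ec horner_prod big_map.
rewrite [RHS](eq_bigr (fun t => -1 * (t - e i))); last first.
  by move=> t _; rewrite !hornerE mulN1r opprB.
rewrite big_split /= big_const_seq iter_mulr mulr1; congr (_ * _).
rewrite big_seq_cond [RHS]big_seq_cond; apply: eq_bigl => t.
by case tin: (t \in ts); rewrite //= vt.
Qed.

(** The factor formed by the roots of least value is defined over [k] and nonconstant, so by
    irreducibility every root of [M] is a root of it. *)
Lemma conj_val M z z' : is_minpoly j M z -> root M^j z' -> v z = v z'.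
Proof.
move=> HM; have [rs Ers] := closed_field_poly_normal M^j.
have [mM Mz _] := HM; rewrite lead_coef_map (monicP mM) rmorph1 scale1r in Ers.
have Hrs i : range j (\prod_(t <- rs) ('X - t%:P))`_i.
  by rewrite -Ers coef_map; exists M`_i.
have zin : z \in rs by rewrite -root_prod_XsubC -Ers.
have [t0 t0in t0min] := seq_min_val zin.
suff Ht t : root M^j t -> v t = v t0 by move=> Mz'; rewrite !Ht.
move=> Mt; have HMt := is_minpoly_root HM Mt.
have [A EA] := min_value_factor t0in Hrs t0min.
have AM : A %| M.
  rewrite -(dvdp_map j) EA Ers [X in _ %| X](bigID (fun t => v t == v t0)) /=.
  exact: dvdp_mulIl.
have At0 : root A^j t0.
  by rewrite EA -big_filter root_prod_XsubC mem_filter eqxx.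
case/orP: (is_minpoly_dvdp HMt AM) => [|/eqP sA].
  by rewrite EA -big_filter root_prod_XsubC mem_filter => /andP[/eqP].
move: At0; have /eqP/size_poly1P[c c0 ->] := sA.
by rewrite map_polyC rootC fmorph_eq0 (negPf c0).
Qed.

(** g(z) and g(z') are roots of the same minimal polynomial N, since [M] divides N(g(X)). *)
Lemma conj_val_horner M z z' (g : {poly k}) : is_minpoly j M z -> root M^j z' ->
  v g^j.[z] = v g^j.[z'].
Proof.
move=> HM Mz'; have [N HN] := minpoly_ex (alg g^j.[z]).
apply: (conj_val HN); have [_ Ng _] := HN; have [_ _ Mdiv] := HM.
have /Mdiv/dvdpP[q Eq] : root (N \Po g)^j z.
  by rewrite map_comp_poly rootE horner_comp (rootP Ng).
have : root (N \Po g)^j z' by rewrite Eq rmorphM rootM Mz' orbT.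
by rewrite map_comp_poly rootE horner_comp.
Qed.

(** Let [b] be the Hensel root near [a]. A conjugate b' of [b] over [L] is also a root of [p], and
    b' - a is conjugate to b - a, so b' is as near to [a] and uniqueness gives b' = b. As [b] is a
    simple root, it lies in [L]. *)
Lemma henselian_extension L : subfield L -> range j `<=` L -> henselian v L.
Proof.
move=> sL jL; apply/henselianP; split=> // p a Hp Lp La a1 pa p'a.
have [k' [j' EL]] := subfield_is_range sL; subst L.
have [b [pb ba]] := closed_hensel_root pa p'a.
have algL z : algebraicOver j' z.
  apply: algebraic_trans (alg z) => c.
  by have [c' _ <-] : range j' (j c); [apply: jL; exists c | apply: algebraic_id].
exists b; split=> //; have [M HM] := minpoly_ex (algL b).
have [p1 Ep] := poly_range Lp.
apply: (simple_root_fixed (p := p1) HM); first by rewrite -Ep.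
  by rewrite -deriv_map -Ep -(val_lt0 v) (hensel_deriv Hp a1 ba p'a) val_lt0 oner_neq0.
move=> b' Mb'; have [mM Mb Mdiv] := HM.
have pb' : root p b'.
  rewrite Ep; rewrite Ep in pb; have /dvdpP[q ->] := Mdiv _ pb.
  by rewrite rmorphM rootM Mb' orbT.
have [a' _ Ea] := La.
(* The minimal polynomial is taken over [k], since equality of conjugate values is so far available
   only there. *)
have [N HN] := minpoly_ex (alg (b - a)); have [_ Nba _] := HN.
have [N' EN] : exists N', N^j = map_poly j' N'.
  by apply: poly_range => i; apply: jL; rewrite coef_map; exists N`_i.
have shift c : (map_poly j' (N' \Po ('X - a'%:P))).[c] = N^j.[c - a].
  by rewrite map_comp_poly rmorphB /= map_polyX map_polyC /= horner_comp !hornerE Ea EN.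
have /Mdiv/dvdpP[q Eq] : root (map_poly j' (N' \Po ('X - a'%:P))) b.
  by rewrite rootE shift.
have Nb' : root N^j (b' - a).
  by rewrite rootE -shift Eq rmorphM hornerM (rootP Mb') mulr0.
apply: esym (hensel_root_unique Hp a1 p'a pb pb' ba _).
by rewrite -(conj_val HN Nb').
Qed.

End ConjugateValues.

(** * Approximation types *)

Section ApproximationTypeTheory.
Variables (K : fieldType) (F : closedFieldType) (G : oagType).
Variables (iota : {rmorphism K -> F}) (v : valuation F G) (x : F).
Local Notation "p ^iota" := (map_poly iota p) (at level 2, format "p ^iota").
Implicit Types (f : {poly K}) (c : K) (phi psi : K -> Prop) (h i n : nat).

(** The threshold of [tends_to] is given by an element c0 of [K] instead of a value; when no c in
    [K] is nearest to x, the two notions agree. *)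
Definition near_elt phi :=
  exists c0, forall c, v (x - iota c0) <= v (x - iota c) -> phi c.

Hypothesis no_max : forall c, exists c', v (x - iota c) < v (x - iota c').
Hypothesis fixed : forall f, exists a, near_elt (fun c => v (iota f.[c]) = a).

Lemma near_and phi psi : near_elt phi -> near_elt psi ->
  near_elt (fun c => phi c /\ psi c).
Proof.
move=> [c1 H1] [c2 H2].
have [le|/ltW le] := leP (v (x - iota c1)) (v (x - iota c2)).
  by exists c2 => c lec; split; [apply/H1/(le_trans le)|apply: H2].
by exists c1 => c lec; split; [apply: H1|apply/H2/(le_trans le)].
Qed.

Lemma near_mono phi psi : (forall c, phi c -> psi c) -> near_elt phi -> near_elt psi.
Proof. by move=> H [c0 H0]; exists c0 => c /H0/H. Qed.

Lemma near_ex phi : near_elt phi -> exists c, phi c.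
Proof. by move=> [c0 H0]; exists c0; apply: H0. Qed.

Lemma near_all phi : (forall c, phi c) -> near_elt phi.
Proof. by move=> H; exists 0. Qed.

Lemma near_lt c0 : near_elt (fun c => v (x - iota c0) < v (x - iota c)).
Proof. by have [c1 lt] := no_max c0; exists c1 => c; apply: lt_le_trans. Qed.

Lemma near_forall n (phi : nat -> K -> Prop) :
  (forall i, near_elt (phi i)) -> near_elt (fun c => forall i, (i < n)%N -> phi i c).
Proof.
move=> H; elim: n => [|n IH]; first exact: near_all.
apply: near_mono (near_and (H n) IH) => c [H1 H2] i.
by rewrite ltnS leq_eqVlt => /predU1P[->|/H2].
Qed.

(** The threshold v(x - c0) is an element of vK because it equals v(c1 - c0) for any c1 closer to
    x. *)
Lemma near_tends_to phi : near_elt phi <-> tends_to iota v x phi.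
Proof.
split=> [[c0 H0]|[g [_ [c0 H0] H]]]; last first.
  by exists c0 => c /(le_trans H0); apply: H.
have [c1 lt] := no_max c0.
have E : v (x - iota c0) = v (iota (c1 - c0)).
  rewrite rmorphB -[iota c1 - _](_ : (x - iota c0) - (x - iota c1) = _); last by ring.
  by rewrite [RHS]val_subl.
have [g Eg] := val_fin v (val_neq0 lt).
exists g; rewrite /value_group /appr -Eg; split.
- by exists (iota (c1 - c0)); rewrite -?E //; exists (c1 - c0).
- by exists c0; apply: lexx.
- exact: H0.
Qed.

Lemma sub_x_neq0 c : x - iota c != 0.
Proof. by have [c' /val_neq0] := no_max c. Qed.

(* As c approaches x, the least index at which [v (b i * (x - c) ^+ i)] is
   minimal can only decrease, so it is eventually constant. *)
Lemma dominant_index_ex (b : nat -> F) n : (exists i, (0 < i <= n)%N /\ b i != 0) ->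
  exists h, [/\ (0 < h <= n)%N, b h != 0 & near_elt (fun c =>
    forall i, (0 < i <= n)%N -> i != h ->
      v (b h * (x - iota c) ^+ h) < v (b i * (x - iota c) ^+ i))].
Proof.
move=> [i0 [i0n bi0]].
pose m c i := v (b i * (x - iota c) ^+ i).
pose first c h := [/\ (0 < h <= n)%N, forall i, (0 < i <= n)%N -> m c h <= m c i
  & forall i, (0 < i < h)%N -> m c h < m c i].
have first_ex c : exists h, first c h.
  pose A h := `[< (0 < h <= n)%N /\ forall i, (0 < i <= n)%N -> m c h <= m c i >].
  have exA : exists h, A h.
    case/andP: (i0n) => i0p i0le.
    have i0lt : (i0 < n.+1)%N by [].
    case: (Order.TotalTheory.arg_minP (fun i : 'I_n.+1 => m c i)
      (i0 := Ordinal i0lt) (P := fun i : 'I_n.+1 => (0 < i)%N)) => //= l lp Hl.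
    exists l; apply/asboolP; split; first by rewrite lp -ltnS ltn_ord.
    by move=> i /andP[ip ile]; apply: (Hl (Ordinal (ile : (i < n.+1)%N))).
  case: (ex_minnP exA) => h /asboolP[hn hmin] hfirst.
  exists h; split=> // i /andP[ip ih]; rewrite ltNge; apply/negP => le.
  have: A i.
    apply/asboolP; split=> [|l ln].
      by case/andP: hn => _ ?; rewrite ip (leq_trans (ltnW ih)).
    exact: le_trans le (hmin l ln).
  by move/hfirst; rewrite leqNgt ih.
(* The smallest index that occurs for any c is the eventual one. *)
pose B h := `[< exists c, first c h >].
have exB : exists h, B h.
  by have [h Hh] := first_ex 0; exists h; apply/asboolP; exists 0.
case: (ex_minnP exB) => h /asboolP[c0 [hn hmin hfirst]] minh.
have bn0 i c : b i != 0 -> b i * (x - iota c) ^+ i != 0.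
  by move=> ?; rewrite mulf_neq0 // expf_neq0 // sub_x_neq0.
have bh : b h != 0.
  apply: contraTneq (hmin i0 i0n) => bh0.
  by rewrite /m bh0 mul0r -ltNge val_lt0 bn0.
exists h; split=> //; apply: near_mono (near_lt c0) => c lt.
(* Passing from c0 to c multiplies the i-th term by the i-th power of [u], of positive value, and so
   penalizes larger indices more. *)
pose u := (x - iota c) / (x - iota c0).
have u1 : v 1 < v u by rewrite -(divff (sub_x_neq0 c0)) lt_val_pM2r ?invr_eq0 ?sub_x_neq0.
have u0 : u != 0 by rewrite mulf_neq0 ?invr_eq0 ?sub_x_neq0.
have mE i : m c i = v (b i * (x - iota c0) ^+ i * u ^+ i).
  by rewrite /m -mulrA -exprMn mulrC mulrC /u mulrCA divff ?mulr1 ?sub_x_neq0.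
have uX l l' : (l < l')%N -> v (u ^+ l) < v (u ^+ l').
  move=> ll; rewrite -(subnKC (ltnW ll)) exprD -{1}[u ^+ l]mulr1 lt_val_pM2l.
    by rewrite -[1](expr1n _ (l' - l)) lt_valX // subn_gt0.
  by rewrite expf_neq0.
have [h' [h'n h'min h'first]] := first_ex c.
have leh : (h <= h')%N by apply: minh; apply/asboolP; exists c.
have gth i : (0 < i <= n)%N -> (h < i)%N -> m c h < m c i.
  move=> iN hi; rewrite !mE.
  have [->|bi] := eqVneq (b i) 0.
    by rewrite !mul0r val_lt0 mulf_neq0 ?bn0 ?expf_neq0.
  apply: le_lt_trans (_ : v (b i * (x - iota c0) ^+ i * u ^+ h) < _).
    by apply: le_valM2r; apply: hmin.
  by rewrite lt_val_pM2l ?bn0 //; apply: uX.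
have Eh : h' = h.
  apply/eqP; rewrite eqn_leq leh andbT leqNgt; apply/negP => hh'.
  by have := gth h' h'n hh'; rewrite ltNge h'min.
rewrite -/(m c) => i iN ih.
have [lti|gti|] := ltngtP i h; last by move/eqP; rewrite (negPf ih).
  by rewrite -Eh; apply: h'first; case/andP: iN => -> _; rewrite Eh.
exact: gth.
Qed.

Lemma nderivn_lead f : f^`N((size f).-1) = (lead_coef f)%:P.
Proof.
apply/polyP => i; rewrite coef_nderivn coefC; case: i => [|i].
  by rewrite addn0 binn mulr1n.
by rewrite nth_default ?mul0rn // addnS; case: (size f) => //= n; rewrite ltnS leq_addr.
Qed.

Lemma taylor_sub f c : f^iota.[x] - iota f.[c] =
  \sum_(i < (size f).-1) iota f^`N(i.+1).[c] * (x - iota c) ^+ i.+1.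
Proof.
have -> : f^iota.[x] = f^iota.[iota c + (x - iota c)] by congr _.[_]; ring.
rewrite (@nderiv_taylor_wide _ (size f).-1.+1); first last.
- by rewrite size_map_poly leqSpred.
- exact: mulrC.
rewrite big_ord_recl nderivn0 expr0 mulr1 horner_map addrC addKr.
by apply: eq_bigr => i _; rewrite nderivn_map horner_map.
Qed.

(** Only the values of the Taylor coefficients matter, so [b] may be read off at a fixed element of
    [K] or at x itself. *)
Lemma val_taylor_sub f c (b : nat -> F) h :
  (0 < h <= (size f).-1)%N -> b h != 0 ->
  (forall i, (0 < i <= (size f).-1)%N -> v (iota f^`N(i).[c]) = v (b i)) ->
  (forall i, (0 < i <= (size f).-1)%N -> i != h ->
      v (b h * (x - iota c) ^+ h) < v (b i * (x - iota c) ^+ i)) ->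
  v (f^iota.[x] - iota f.[c]) = v (b h * (x - iota c) ^+ h).
Proof.
case: h => // h hn bh Hb Hdom; have hlt : (h < (size f).-1)%N by [].
have vE i : (i < (size f).-1)%N ->
    v (iota f^`N(i.+1).[c] * (x - iota c) ^+ i.+1) = v (b i.+1 * (x - iota c) ^+ i.+1).
  by move=> lti; rewrite !valuationM Hb.
rewrite taylor_sub (bigD1 (Ordinal hlt)) //= val_addl vE //.
apply: lt_val_sum => [|[i lti] /= ih].
  by rewrite mulf_neq0 // expf_neq0 // sub_x_neq0.
by rewrite vE //; apply: Hdom => //; rewrite -(inj_eq val_inj) /= in ih.
Qed.

(* [v (f(x) - f(c))] increases strictly as c approaches x, and v f(c) is fixed. *)
Lemma near_val_lt_sub f : (1 < size f)%N ->
  near_elt (fun c => v (iota f.[c]) < v (f^iota.[x] - iota f.[c])).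
Proof.
move=> sf; pose n := (size f).-1.
have /choice[a Ha] i : exists a, near_elt (fun c => v (iota f^`N(i).[c]) = a).
  exact: fixed.
have nearA : near_elt (fun c => forall i, (i < n.+1)%N -> v (iota f^`N(i).[c]) = a i).
  exact: near_forall.
have [c1 H1] := near_ex nearA; pose b i := iota f^`N(i).[c1].
have [|h [hn bh Hdom]] := @dominant_index_ex b n.
  exists n; rewrite leqnn /n -{1}subn1 subn_gt0 sf; split=> //.
  by rewrite /b nderivn_lead hornerC fmorph_eq0 lead_coef_eq0 -size_poly_gt0 ltnW.
have [c0 H0] := near_and nearA Hdom.
have key c : v (x - iota c0) <= v (x - iota c) ->
    v (f^iota.[x] - iota f.[c]) = v (b h * (x - iota c) ^+ h).
  move=> /H0[Hc Hd]; apply: val_taylor_sub => // i /andP[_ lei].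
  by rewrite Hc // -H1.
apply: near_mono (near_lt c0) => c lt.
have lt' : v (f^iota.[x] - iota f.[c0]) < v (f^iota.[x] - iota f.[c]).
  rewrite !key ?lexx ?(ltW lt) // lt_val_pM2l // lt_valX //; by case/andP: hn.
have E : v (iota f.[c]) = v (iota f.[c0]).
  have [/(_ 0 isT) + _] := H0 _ (ltW lt); have [/(_ 0 isT) + _] := H0 _ (lexx _).
  by rewrite nderivn0 => -> ->.
apply: (le_lt_trans _ lt'); rewrite -(val_subl lt').
have -> : f^iota.[x] - iota f.[c0] - (f^iota.[x] - iota f.[c]) =
  iota f.[c] - iota f.[c0] by ring.
by apply: le_val_sub; rewrite ?E.
Qed.

Lemma near_val_eq f : near_elt (fun c => v (iota f.[c]) = v f^iota.[x]).
Proof.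
have [|sf] := ltnP 1 (size f).
  move/near_val_lt_sub; apply: near_mono => c lt; symmetry; apply: val_close.
  by rewrite valB.
apply: near_all => c; have /size1_polyC -> := sf.
by rewrite map_polyC !hornerC.
Qed.

(* [f^`N(i)] has the fixed value [v f^`N(i).[x]], so this is the characterization
   of the relative approximation degree with that value for beta_i. *)
Definition dominant_index f h := (0 < h <= (size f).-1)%N /\
  near_elt (fun c => forall i, (0 < i <= (size f).-1)%N -> i != h ->
    v (f^`N(h)^iota.[x] * (x - iota c) ^+ h) < v (f^`N(i)^iota.[x] * (x - iota c) ^+ i)).

Lemma nderivn_lead_neq0 f : (1 < size f)%N -> f^`N((size f).-1)^iota.[x] != 0.
Proof.
move=> sf; rewrite nderivn_lead map_polyC hornerC fmorph_eq0 lead_coef_eq0.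
by rewrite -size_poly_gt0 ltnW.
Qed.

Lemma dominant_index_neq0 f h : dominant_index f h -> f^`N(h)^iota.[x] != 0.
Proof.
move=> [hn /near_ex[c Hc]]; have sf : (1 < size f)%N.
  by case/andP: hn; case: (size f) => [|[|n]] //= h0; rewrite leqNgt h0.
have [->|nh] := eqVneq h (size f).-1; first exact: nderivn_lead_neq0.
have := Hc (size f).-1; rewrite eq_sym nh leqnn -{1}subn1 subn_gt0 sf => /(_ isT isT).
by move/val_neq0; rewrite mulf_eq0 negb_or => /andP[].
Qed.

Lemma dominant_index_poly_ex f : (1 < size f)%N -> exists h, dominant_index f h.
Proof.
move=> sf; have [|h [hn _ Hd]] := @dominant_index_ex (fun i => f^`N(i)^iota.[x]) (size f).-1.
  exists (size f).-1; rewrite leqnn -{1}subn1 subn_gt0 sf; split=> //.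
  exact: nderivn_lead_neq0.
by exists h.
Qed.

Lemma near_val_sub f h : dominant_index f h ->
  near_elt (fun c => v (f^iota.[x] - iota f.[c]) = v (f^`N(h)^iota.[x] * (x - iota c) ^+ h)).
Proof.
move=> Hh; have h0 := dominant_index_neq0 Hh; case: Hh => hn Hd.
have H : near_elt (fun c => forall i, (i < size f)%N ->
    v (iota f^`N(i).[c]) = v f^`N(i)^iota.[x]).
  by apply: near_forall => i; exact: near_val_eq.
apply: near_mono (near_and Hd H) => c [Hc Hv].
apply: (val_taylor_sub (b := fun i => f^`N(i)^iota.[x])) => // i /andP[i0 lei].
by apply: Hv; have := leq_trans i0 lei; move: lei; case: (size f).
Qed.

Lemma rel_approx_degree_dominant f h :
  is_rel_approx_degree iota v x f h <-> dominant_index f h.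
Proof.
pose n := (size f).-1.
have H : near_elt (fun c => forall i, (i < n.+1)%N ->
    v (iota f^`N(i).[c]) = v f^`N(i)^iota.[x]).
  by apply: near_forall => i; exact: near_val_eq.
have vMn a m : v a *+ m = v (a ^+ m).
  elim: m => [|m IH]; first by rewrite mulr0n expr0 valuation1.
  by rewrite mulrS exprS valuationM IH.
split=> [[b [Hb hn /near_tends_to Hd]]|[hn Hd]].
  split=> //.
  have bE i : (0 < i <= n)%N -> b i = v f^`N(i)^iota.[x].
    move=> iN; have [_ /near_tends_to Hbi] := Hb i iN.
    have [c [E1 E2]] := near_ex (near_and Hbi H).
    by rewrite -E1 E2 //; case/andP: iN.
  apply: near_mono Hd => c Hc i iN ih; have := Hc i iN ih.
  by rewrite !bE // !vMn -!valuationM.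
exists (fun i => v f^`N(i)^iota.[x]); split=> //.
- move=> i iN; split; last by apply/near_tends_to; exact: near_val_eq.
  have [c <-] := near_ex (near_val_eq f^`N(i)).
  have [->|n0] := eqVneq (iota f^`N(i).[c]) 0; first by right; rewrite valuation0.
  have [g Eg] := val_fin v n0; left; exists g => //.
  by exists (iota f^`N(i).[c]) => //; exists f^`N(i).[c].
- apply/near_tends_to; apply: near_mono Hd => c Hc i iN ih.
  by rewrite !vMn -!valuationM; apply: Hc.
Qed.

(** For c near x, v f(x) = v f(c) < v(f(x) - f(c)), and the latter is at most the value of the top
    Taylor term. The bound depends only on the degree and the leading coefficient. *)
Lemma near_val_horner_le f g : (1 < size f)%N ->
  (forall c, v (x - iota c) < v g) ->
  v f^iota.[x] <= v (iota (lead_coef f) * g ^+ (size f).-1).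
Proof.
move=> sf Hg; have [h Hh] := dominant_index_poly_ex sf; have [hn Hd] := Hh.
have n0 : (0 < (size f).-1)%N by rewrite -subn1 subn_gt0.
have [c [[Hdc Hs] [Hlt He]]] := near_ex (near_and (near_and Hd (near_val_sub Hh))
  (near_and (near_val_lt_sub sf) (near_val_eq f))).
rewrite -He; apply: le_trans (ltW Hlt) _; rewrite Hs.
apply: le_trans (_ : v (iota (lead_coef f) * (x - iota c) ^+ (size f).-1) <= _).
  have [->|nh] := eqVneq h (size f).-1.
    by rewrite nderivn_lead map_polyC hornerC.
  apply/ltW; have := Hdc (size f).-1; rewrite eq_sym nh leqnn n0 => /(_ isT isT).
  by rewrite nderivn_lead map_polyC hornerC.
by apply/le_valM2l/le_valX/ltW.
Qed.

(** * Density of K[u] in the henselization of K(u) *)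

Hypothesis arch : archimedean_val v.
Hypothesis val_nontrivial : exists2 w, w != 0 & v 1 < v w.

Definition val_closure (A : set F) : set F :=
  [set z | forall w, w != 0 -> exists2 a, A a & v w <= v (z - a)].

Definition poly_values (u : F) : set F := [set w | exists p : {poly K}, w = p^iota.[u]].

Lemma sub_val_closure A : A `<=` val_closure A.
Proof. by move=> a Aa w _; exists a => //; rewrite subrr le_val0. Qed.

Lemma val_closure_closed A : closed_val v (val_closure A).
Proof.
move=> z Hz w w0; have [b Hb zb] := Hz w w0; have [a Aa ba] := Hb w w0.
exists a => //; have -> : z - a = (z - b) + (b - a) by ring.
exact: le_val_add.
Qed.

Lemma poly_approx f : f^iota.[x] != 0 ->
  exists c, v f^iota.[x] < v (f^iota.[x] - iota c).
Proof.
move=> f0; have [sf|sf] := ltnP 1 (size f); last first.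
  have /size1_polyC Ef := sf; exists f`_0.
  by rewrite {2}Ef map_polyC hornerC subrr val_lt0.
have [c [Hlt He]] := near_ex (near_and (near_val_lt_sub sf) (near_val_eq f)).
by exists f.[c]; rewrite -He.
Qed.

Section ClosureOfPolynomialValues.
(** Three choices are used: X and X^q for limits of K[x] and K[x^q], and 0 for limits of [K]
    alone. *)
Variable U : {poly K}.
Local Notation u := (U^iota.[x]).
Local Notation A := (val_closure (poly_values u)).

Lemma closure_approx z : A z -> z != 0 -> exists c, v z < v (z - iota c).
Proof.
move=> Az z0; have [w w0 w1] := val_nontrivial.
have lt0 : v z < v (z * w) by rewrite -{1}[z]mulr1 lt_val_pM2l.
have [a [p Ea] Ha] := Az _ (mulf_neq0 z0 w0).
have za : v z < v (z - a) by apply: lt_le_trans Ha.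
have va : v a = v z := val_close za.
have Eax : a = (p \Po U)^iota.[x] by rewrite map_comp_poly horner_comp.
have [|c Hc] := @poly_approx (p \Po U); first by rewrite -Eax -(val_lt0 v) va val_lt0.
exists c; rewrite -Eax va in Hc.
have -> : z - iota c = (z - a) + (a - iota c) by ring.
exact: lt_val_add.
Qed.

Lemma closureB a b : A a -> A b -> A (a - b).
Proof.
move=> Aa Ab w w0; have [a' [p Ea] Ha] := Aa w w0; have [b' [q Eb] Hb] := Ab w w0.
exists (a' - b'); first by exists (p - q); rewrite Ea Eb rmorphB !hornerE.
have -> : a - b - (a' - b') = (a - a') - (b - b') by ring.
exact: le_val_sub.
Qed.

Lemma closure_const c : A (iota c).
Proof. by apply: sub_val_closure; exists c%:P; rewrite map_polyC hornerC. Qed.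

Lemma closureM a b : A a -> A b -> A (a * b).
Proof.
move=> Aa Ab w w0; have [->|b0] := eqVneq b 0.
  by exists 0; [exists 0; rewrite rmorph0 horner0 | rewrite mulr0 subr0 le_val0].
have [a' [p Ea] Ha] := Aa (w / b) (mulf_neq0 w0 (invr_neq0 b0)).
have Hab : v w <= v ((a - a') * b) by rewrite -[w](divfK b0); apply: le_valM2r.
(* If the approximation of [a] is 0, then [a * b] already has value at least [v w]; otherwise a
   precision can be divided by a'. *)
have [a0|a0] := eqVneq a' 0.
  exists 0; first by exists 0; rewrite rmorph0 horner0.
  by move: Hab; rewrite a0 !subr0.
have [b' [q Eb] Hb] := Ab (w / a') (mulf_neq0 w0 (invr_neq0 a0)).
exists (a' * b'); first by exists (p * q); rewrite Ea Eb rmorphM hornerM.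
have -> : a * b - a' * b' = (a - a') * b + (b - b') * a' by ring.
by apply: le_val_add => //; rewrite -[w](divfK a0); apply: le_valM2r.
Qed.

(* With [c] in [K] close to [z], [z^-1] is the sum of the geometric series
   [c^-1 * (1 + t + t^2 + ...)] where [t = 1 - z / c]. *)
Lemma closureV z : A z -> A z^-1.
Proof.
move=> Az; have [z0|z0] := eqVneq z 0.
  by rewrite z0 invr0 -(rmorph0 iota); apply: closure_const.
have [c zc] := closure_approx Az z0.
have vc : v (iota c) = v z := val_close zc.
have c0 : iota c != 0 by rewrite -(val_lt0 v) vc val_lt0.
pose t := 1 - z / iota c.
have At : A t.
  apply: closureB; first by rewrite -(rmorph1 iota); apply: closure_const.
  by apply: closureM => //; rewrite -fmorphV; apply: closure_const.
have t1 : v 1 < v t.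
  rewrite /t -{1}(divff z0) -(divff c0) -mulrBl.
  rewrite -(@lt_val_pM2r _ _ v (iota c)) // divfK // valuationM vc -valuationM.
  by rewrite divfK // valB.
apply: val_closure_closed => w w0.
have [n Hn] := arch t1 (mulf_neq0 w0 z0).
exists ((iota c)^-1 * \sum_(i < n) t ^+ i).
  apply: closureM; first by rewrite -fmorphV; apply: closure_const.
  elim: n {Hn} => [|n IH]; first by rewrite big_ord0 -(rmorph0 iota); apply: closure_const.
  rewrite big_ord_recr /= -[X in _ + X]opprK; apply: closureB => //.
  rewrite -sub0r; apply: closureB; first by rewrite -(rmorph0 iota); apply: closure_const.
  elim: n {IH} => [|n IH]; first by rewrite expr0 -(rmorph1 iota); apply: closure_const.
  by rewrite exprS; apply: closureM.
have -> : z^-1 - (iota c)^-1 * (\sum_(i < n) t ^+ i) = t ^+ n / z.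
  apply: (mulfI z0); rewrite [RHS]mulrC divfK // mulrBr divff // mulrA.
  have -> : z / iota c = 1 - t by rewrite /t; ring.
  by rewrite -[1 - t]opprB mulNr -subrX1; ring.
by rewrite -(@le_val_pM2r _ _ v z) // divfK.
Qed.

Lemma subfield_closure : subfield A.
Proof.
apply/subfieldP; split; first by rewrite -(rmorph1 iota); apply: closure_const.
  exact: closureB.
by move=> a b Aa Ab; apply: closureM => //; apply: closureV.
Qed.

(** The closure is a closed subfield containing K(u), hence henselian by Newton's iteration. *)
Lemma henselization_closure :
  henselization v (adjoin (range iota) u) `<=` A.
Proof.
apply: henselization_sub.
  exact: closed_subfield_henselian arch subfield_closure (@val_closure_closed _).
apply: adjoin_sub; first exact: subfield_closure.
- by move=> _ [c _ <-]; apply: closure_const.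
- by apply: sub_val_closure; exists 'X; rewrite map_polyX hornerX.
Qed.
End ClosureOfPolynomialValues.

Lemma poly_values0 w : poly_values 0 w -> range iota w.
Proof. by move=> [p ->]; exists p.[0]; rewrite // -horner_map rmorph0. Qed.

Hypothesis bounded : exists2 g, g != 0 & forall c, v (x - iota c) < v g.

(** Replacing the coefficients of [p] by nearby elements of [K] gives a monic q over [K] with q(x)
    arbitrarily small, while [near_val_horner_le] bounds v q(x) by n v(g). *)
Lemma not_root_monic (p : {poly F}) : p \is monic -> (1 < size p)%N ->
  (forall i, val_closure (range iota) p`_i) -> ~ root p x.
Proof.
move=> mp sp Hp /rootP px; have [g g0 Hg] := bounded; have [w w0 w1] := val_nontrivial.
(* [v W] lies just above the bound n v(g); the precision W / x^i for coefficient i makes every error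
   term at least [v W]. *)
pose n := (size p).-1; pose W := g ^+ n * w.
have W0 : W != 0 by rewrite mulf_neq0 ?expf_neq0.
have x0 : x != 0 by have := sub_x_neq0 0; rewrite rmorph0 subr0.
have /choice[a Ha] i : exists a, v (W / x ^+ i) <= v (p`_i - iota a).
  have [|_ [a _ <-] Ha] := Hp i (W / x ^+ i); last by exists a.
  by rewrite mulf_neq0 ?invr_eq0 ?expf_neq0.
pose q := 'X^n + \poly_(i < n) a i.
have sq : size q = n.+1 by rewrite size_polyDl size_polyXn // ltnS size_poly.
have lq : lead_coef q = 1.
  by rewrite lead_coefDl ?lead_coefXn // size_polyXn ltnS size_poly.
have n0 : (0 < n)%N by rewrite /n -subn1 subn_gt0.
have := @near_val_horner_le q g; rewrite sq lq rmorph1 mul1r => /(_ n0 Hg).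
apply/negP; rewrite -ltNge.
apply: lt_le_trans (_ : v W <= _).
  by rewrite /W -{1}[g ^+ n]mulr1 lt_val_pM2l ?expf_neq0.
have -> : q^iota.[x] = - \sum_(i < n) (p`_i - iota (a i)) * x ^+ i.
  transitivity (q^iota.[x] - p.[x]); first by rewrite px subr0.
  rewrite [p.[x]]horner_coef -(prednK (ltnW sp)) big_ord_recr /=.
  rewrite -/n -lead_coefE (monicP mp) mul1r rmorphD /= map_polyXn !hornerE.
  rewrite (@horner_coef_wide _ n); last by rewrite size_map_poly size_poly.
  rewrite [X in _ + X - _](eq_bigr (fun i : 'I_n => iota (a i) * x ^+ i)); last first.
    by move=> i _; rewrite coef_map coef_poly ltn_ord.
  have -> : \sum_(i < n) (p`_i - iota (a i)) * x ^+ i =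
      \sum_(i < n) p`_i * x ^+ i - \sum_(i < n) iota (a i) * x ^+ i.
    by rewrite -sumrB; apply: eq_bigr => i _; rewrite mulrBl.
  by ring.
rewrite valN; apply: le_val_sum => i _.
by rewrite -[W](divfK (expf_neq0 i x0)); apply: le_valM2r.
Qed.


(** Comparing the two equalities leaves equal values for two powers of [u], which forces equal
    exponents. *)
Lemma monomial_val_inj (d u : F) h1 h2 (a1 a2 : F) : d != 0 -> v 1 < v u -> u != 0 ->
  a1 != 0 -> a2 != 0 -> v (a2 * d ^+ h2) = v (a1 * d ^+ h1) ->
  v (a2 * (d * u) ^+ h2) = v (a1 * (d * u) ^+ h1) -> h2 = h1 /\ v a2 = v a1.
Proof.
move=> d0 u1 u0 a10 a20 E0; rewrite !exprMn !mulrA => E1.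
have Eu : v (u ^+ h2) = v (u ^+ h1).
  have n0 : a2 * d ^+ h2 != 0 by rewrite mulf_neq0 ?expf_neq0.
  by apply: (val_pmulI n0); rewrite E1 ![v (_ * u ^+ h1)]valuationM E0.
have lt_exp m n : (m < n)%N -> v (u ^+ m) < v (u ^+ n).
  move=> lt; rewrite -(subnKC (ltnW lt)) exprD -{1}[u ^+ m]mulr1.
  by rewrite lt_val_pM2l ?expf_neq0 // -[1](expr1n _ (n - m)) lt_valX ?subn_gt0.
have Eh : h2 = h1.
  by case: (ltngtP h2 h1) => // /lt_exp; rewrite Eu ltxx.
split=> //; move: E0; rewrite Eh => E0; have n0 := expf_neq0 h1 d0.
by apply: (val_pmulI n0); rewrite mulrC E0 mulrC.
Qed.

(** * Independence of h from the approximating polynomial *)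

Section BestApproximation.
Variable y : F.
Hypothesis y_no_max : forall c, exists c', v (y - iota c) < v (y - iota c').

Lemma best_approx_lt f c : (forall c, v (y - iota c) <= v (y - f^iota.[x])) ->
  v (y - iota c) < v (y - f^iota.[x]).
Proof. by move=> Hf; have [c' lt] := y_no_max c; apply: lt_le_trans lt _. Qed.

Lemma best_approx_size f : (forall c, v (y - iota c) <= v (y - f^iota.[x])) ->
  (1 < size f)%N.
Proof.
move=> Hf; rewrite ltnNge; apply/negP => /size1_polyC Ef.
by have := best_approx_lt f`_0 Hf; rewrite Ef map_polyC !hornerC coefC ltxx.
Qed.

Lemma best_approx_near f h : (forall c, v (y - iota c) <= v (y - f^iota.[x])) ->
  dominant_index f h ->
  near_elt (fun c => v (y - iota f.[c]) = v (f^`N(h)^iota.[x] * (x - iota c) ^+ h)).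
Proof.
move=> Hf /near_val_sub; apply: near_mono => c <-.
rewrite -(val_subl (best_approx_lt f.[c] Hf)); congr (v _); ring.
Qed.

(** Near x, f1(c) - f2(c) has the fixed value v(f1(x) - f2(x)), which is larger than v(y - f1(c)).
    So y - f1(c) and y - f2(c) have the same value, a monomial in x - c for each polynomial, and two
    choices of c determine exponent and coefficient value. *)
Lemma best_approx_dominant f1 f2 h :
  (forall c, v (y - iota c) <= v (y - f1^iota.[x])) ->
  (forall c, v (y - iota c) <= v (y - f2^iota.[x])) ->
  dominant_index f1 h ->
  dominant_index f2 h /\ v f2^`N(h)^iota.[x] = v f1^`N(h)^iota.[x].
Proof.
move=> H1 H2 D1; have [h2 D2] := dominant_index_poly_ex (best_approx_size H2).
have E : near_elt (fun c => v (f2^`N(h2)^iota.[x] * (x - iota c) ^+ h2) =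
    v (f1^`N(h)^iota.[x] * (x - iota c) ^+ h)).
  apply: near_mono (near_and (near_val_eq (f1 - f2))
    (near_and (best_approx_near H1 D1) (best_approx_near H2 D2))).
  move=> c [E0 [<- <-]].
  have -> : y - iota f2.[c] = (y - iota f1.[c]) + (iota f1.[c] - iota f2.[c]) by ring.
  rewrite hornerD hornerN rmorphB rmorphB hornerD hornerN in E0.
  apply: val_addl; rewrite E0.
  have -> : f1^iota.[x] - f2^iota.[x] = (y - f2^iota.[x]) - (y - f1^iota.[x]) by ring.
  apply: lt_val_sub; last exact: best_approx_lt.
  exact: best_approx_lt.
have [c0 H0] := E; have [c1 lt] := no_max c0.
have E0 := H0 _ (lexx _); have E1 := H0 _ (ltW lt).
have a10 := dominant_index_neq0 D1; have a20 := dominant_index_neq0 D2.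
pose d := x - iota c0; pose u := (x - iota c1) / d.
have d0 : d != 0 := sub_x_neq0 c0.
have Ex : x - iota c1 = d * u by rewrite /u mulrCA divff ?mulr1.
have u1 : v 1 < v u by rewrite -(divff d0) lt_val_pM2r ?invr_eq0.
have u0 : u != 0 by rewrite mulf_neq0 ?invr_eq0 ?sub_x_neq0.
rewrite -/d in E0; rewrite {}Ex in E1.
have [Eh Ea] := monomial_val_inj d0 u1 u0 a10 a20 E0 E1.
by rewrite -Ea; split; rewrite -Eh.
Qed.
End BestApproximation.

End ApproximationTypeTheory.

(** * Rank one and inseparability *)

Section AlgebraicExtensionsOfRankOne.
Variables (F : closedFieldType) (G : oagType) (v : valuation F G).

Lemma valX a n : v (a ^+ n) = v a *+ n.
Proof.
elim: n => [|n IH]; first by rewrite expr0 mulr0n valuation1.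
by rewrite exprS valuationM IH mulrS.
Qed.

Lemma Fin_mulrn (g : G) n : Fin g *+ n = Fin (g *+ n).
Proof. by elim: n => // n IH; rewrite !mulrS IH. Qed.

(** In the equation p(z) = 0 two terms must share the least value; their quotient gives the power of
    z and the element of [E]. *)
Lemma algebraic_val_pow (E : set F) z : subfield E -> algebraic_over E z -> z != 0 ->
  exists n a, [/\ (0 < n)%N, E a, a != 0 & v (z ^+ n) = v a].
Proof.
move=> sE [p [p0 pE pz]] z0; have [_ _ Ed] := (subfieldP E).1 sE.
pose t (i : nat) := p`_i * z ^+ i.
have sp : (0 < size p)%N by rewrite size_poly_gt0.
case: (Order.TotalTheory.arg_minP (fun i : 'I_(size p) => v (t i))
  (i0 := Ordinal sp) (P := xpredT)) => //= i _ Hi.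
have ti : t i != 0.
  rewrite -(val_lt0 v); have sp' : ((size p).-1 < size p)%N by rewrite prednK.
  apply: le_lt_trans (Hi (Ordinal sp') isT) _.
  by rewrite val_lt0 /t mulf_neq0 ?expf_neq0 // -lead_coefE lead_coef_eq0.
have [l [li El]] : exists l : 'I_(size p), l != i /\ v (t l) = v (t i).
  apply: contrapT => H; move: (ti); rewrite -(val_lt0 v).
  have : v (\sum_(l < size p) t l) = v (t i).
    rewrite (bigD1 i) //=; apply: val_addl; apply: lt_val_sum => // l li.
    rewrite lt_neqAle Hi // andbT; apply/eqP => El; apply: H; exists l; split=> //.
  by rewrite -horner_coef (rootP pz) => <-; rewrite ltxx.
have tl : t l != 0 by rewrite -(val_lt0 v) El val_lt0.
have [m [n [lt Emn tm tn]]] : exists m n : nat,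
    [/\ (m < n)%N, v (t m) = v (t n), t m != 0 & t n != 0].
  have [lt|lt|/val_inj e] := ltngtP l i; last by rewrite e eqxx in li.
    by exists l, i.
  by exists i, l.
have pn0 : p`_n != 0 by apply: contraNneq tn => e; rewrite /t e mul0r.
have pm0 : p`_m != 0 by apply: contraNneq tm => e; rewrite /t e mul0r.
exists (n - m)%N, (p`_m / p`_n); split; rewrite ?subn_gt0 ?mulf_neq0 ?invr_eq0 //.
  exact: Ed.
have n0 : p`_n * z ^+ m != 0 by rewrite mulf_neq0 ?expf_neq0.
apply: (val_pmulI n0).
have -> : p`_n * z ^+ m * z ^+ (n - m) = t n by rewrite /t -mulrA -exprD subnKC // ltnW.
by rewrite -Emn /t; congr (v _); field.
Qed.

(** Every value of [F] is torsion modulo the value group of [L], which is that of [E], so suitable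
    powers can be compared there. *)
Lemma rank1_archimedean (E L : set F) : subfield E -> subfield L ->
  value_group v L = value_group v E -> rank1 v E ->
  (forall z, algebraic_over L z) -> archimedean_val v.
Proof.
move=> sE sL EL [_ arch] algL w u w1 u0.
have powE z : z != 0 -> exists n g, [/\ (0 < n)%N, value_group v E g & v (z ^+ n) = Fin g].
  move=> z0; have [n [a [n0 La a0 Ea]]] := algebraic_val_pow sL (algL z) z0.
  have [g Eg] := val_fin v a0; exists n, g; split=> //; last by rewrite Ea.
  by rewrite -EL; exists a.
have [w0|w0] := eqVneq w 0; first by exists 1%N; rewrite w0 expr1 le_val0.
have [u1|u1] := leP (v u) (v 1); first by exists 0%N; rewrite expr0.
have [n [g [n0 Eg vg]]] := powE w w0; have [m [d [m0 Ed vd]]] := powE u u0.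
have g0 : 0 < g.
  have := lt_valX n0 w1; rewrite expr1n vg valuation1 => lt.
  rewrite lt_neqAle; apply/andP; split; last exact: (ltW lt).
  by apply/eqP => e; rewrite e ltxx in lt.
have [N HN] := arch g d Eg Ed g0.
exists (n * N)%N; rewrite exprM; apply: le_trans (_ : v (u ^+ m) <= _).
  case: m m0 {vd} => // m _; rewrite exprS -{1}[u]mulr1; apply/le_valM2l/le_val1X.
  exact: ltW.
by rewrite [X in _ <= X]valX vg vd Fin_mulrn.
Qed.

Lemma rank1_nontrivial (E : set F) : subfield E -> rank1 v E ->
  exists2 w, E w & w != 0 /\ v 1 < v w.
Proof.
move=> sE [[g [a Ea va] g0] _]; have [E1 _ Ed] := (subfieldP E).1 sE.
have a0 : a != 0 by rewrite -(val_lt0 v) va valuation0.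
have [lt|lt|e] := ltgtP (v 1) (v a).
- by exists a.
- exists a^-1; first by rewrite -div1r; apply: Ed.
  rewrite invr_eq0; split=> //.
  by rewrite -(@lt_val_pM2r _ _ v a) // mulVf // mul1r.
- by move: e g0; rewrite va valuation1 => -[<-]; rewrite eqxx.
Qed.

End AlgebraicExtensionsOfRankOne.

Section SimpleExtensions.
Variables (k F : fieldType) (j : {rmorphism k -> F}).
Local Notation "p ^j" := (map_poly j p) (at level 2, format "p ^j").

Lemma minpoly_has_degree M z : is_minpoly j M z ->
  has_degree (adjoin (range j) z) (range j) (size M).-1.
Proof.
move=> HM; have [mM Mz Mdiv] := HM; have M0 := is_minpoly_neq0 HM.
have sM := is_minpoly_size HM.
have algz : algebraicOver j z by exists M.
split; first exact: sub_adjoin.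
exists (fun i => z ^+ i); split.
- move=> i; rewrite adjoin_algebraic //; exists 'X^i.
  by rewrite map_polyXn hornerXn.
- rewrite adjoin_algebraic // => _ [p ->].
  exists (fun i => j (p %% M)`_i); first by move=> i; exists (p %% M)`_i.
  have -> : p^j.[z] = (p %% M)^j.[z].
    by rewrite {1}(divp_eq p M) rmorphD rmorphM !hornerE (rootP Mz) mulr0 add0r.
  rewrite (@horner_coef_wide _ (size M).-1) ?size_map_poly.
    by apply: eq_bigr => i _; rewrite coef_map.
  by rewrite -ltnS prednK ?ltn_modp // ltnW.
- move=> a Ha Sa.
  have /choice[c Hc] i : exists c, j c = a i by have [c _ Ec] := Ha i; exists c.
  pose d := (size M).-1; pose cc (i : nat) := if insub i is Some l then c l else 0.
  have ccE (i : 'I_d) : cc i = c i by rewrite /cc valK.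
  pose p := \poly_(i < d) cc i.
  have sp : (size p < size M)%N.
    by rewrite -[size M]prednK ?(ltnW sM) // ltnS size_poly.
  have p0 : p = 0.
    apply/eqP; apply: contraT => p0.
    have /Mdiv/(dvdp_leq p0) : root p^j z.
      rewrite rootE (@horner_coef_wide _ d) ?size_map_poly ?size_poly // -[X in _ == X]Sa.
      by apply/eqP; apply: eq_bigr => i _; rewrite coef_map coef_poly ltn_ord /= ccE Hc.
    by rewrite leqNgt sp.
  move=> i; rewrite -Hc -ccE.
  have := congr1 (fun q : {poly k} => q`_i) p0.
  by rewrite /= coef_poly ltn_ord coef0 => ->; rewrite rmorph0.
Qed.

End SimpleExtensions.


Lemma uniq_simple_roots (F : fieldType) (rs : seq F) :
  (forall r, r \in rs -> (\prod_(t <- rs) ('X - t%:P))^`().[r] != 0) -> uniq rs.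
Proof.
elim: rs => //= a rs IH H; apply/andP; split.
  apply/negP => ain; have := H a (mem_head _ _); case/eqP.
  have /rootP ra : root (\prod_(t <- rs) ('X - t%:P)) a by rewrite root_prod_XsubC.
  by rewrite big_cons derivM derivXsubC mul1r hornerD ra hornerM hornerXsubC subrr mul0r addr0.
apply: IH => r rin; have := H r; rewrite inE rin orbT => /(_ isT).
have /rootP ra : root (\prod_(t <- rs) ('X - t%:P)) r by rewrite root_prod_XsubC.
rewrite big_cons derivM derivXsubC mul1r hornerD ra add0r hornerM.
by rewrite mulf_eq0 negb_or => /andP[].
Qed.

Section InseparableDegree.
Variables (k : fieldType) (F : closedFieldType) (j : {rmorphism k -> F}).
Local Notation "p ^j" := (map_poly j p) (at level 2, format "p ^j").
Variables (M R : {poly k}) (q : nat) (z : F).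
Hypotheses (HM : is_minpoly j M z) (q0 : (0 < q)%N) (EM : M = R \Po 'X^q).

Lemma insep_size : (size M).-1 = ((size R).-1 * q)%N.
Proof. by rewrite EM size_comp_poly size_polyXn. Qed.

Lemma insep_size_gt1 : (0 < (size R).-1)%N.
Proof.
have := is_minpoly_size HM; rewrite -[(1 < _)%N]subn_gt0 subn1 insep_size muln_gt0.
by case/andP.
Qed.

Lemma insep_root a : root R^j (a ^+ q) = root M^j a.
Proof. by rewrite EM map_comp_poly map_polyXn !rootE horner_comp hornerXn. Qed.

(** A multiple root of [R] would yield a root of [M] at which R'(X^q) vanishes, although R'(X^q) is
    nonzero of smaller degree. One q-th root of each root of [R] then gives the list. *)
Lemma distinct_conjugates : R^`() != 0 -> exists xs : seq F,
  [/\ uniq xs, (size xs * q)%N = (size M).-1 & forall a, a \in xs -> root M^j a].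
Proof.
move=> R'0; have [rs Ers] := closed_field_poly_normal R^j.
have R0 : R != 0 by apply: contraNneq R'0 => ->; rewrite deriv0.
have l0 : lead_coef R^j != 0 by rewrite lead_coef_eq0 map_poly_eq0.
have /choice[s Hs] (r : F) : exists a, a ^+ q = r.
  have : size ('X^q - r%:P) != 1%N by rewrite size_XnsubC // eqSS -lt0n.
  move/closed_rootP => [a]; rewrite rootE !hornerE subr_eq0 => /eqP <-.
  by exists a.
have Rr r : r \in rs -> root R^j r.
  by move=> rin; rewrite Ers rootE hornerZ (rootP (_ : root _ r)) ?mulr0 ?root_prod_XsubC.
have urs : uniq rs.
  apply: uniq_simple_roots => r rin.
  suff : R^`()^j.[r] != 0.
    by rewrite -deriv_map Ers derivZ hornerZ mulf_eq0 negb_or => /andP[].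
  have Ms : root M^j (s r) by rewrite -insep_root Hs Rr.
  have [_ _ Mdiv] := is_minpoly_root HM Ms.
  apply/eqP => R'r; have : root (R^`() \Po 'X^q)^j (s r).
    by rewrite map_comp_poly map_polyXn rootE horner_comp hornerXn Hs R'r.
  have sX : (1 < size ('X^q : {poly k}))%N by rewrite size_polyXn.
  have n0 : R^`() \Po 'X^q != 0 by rewrite comp_poly_eq0.
  move=> /Mdiv/(dvdp_leq n0); rewrite leqNgt => /negP[].
  have M0 := is_minpoly_neq0 HM.
  rewrite -[size M]prednK ?size_poly_gt0 // -[size (_ \Po _)]prednK ?size_poly_gt0 //.
  rewrite ltnS insep_size size_comp_poly size_polyXn /= ltn_pmul2r //.
  rewrite -ltnS !prednK ?size_poly_gt0 //; exact: lt_size_deriv.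
exists (map s rs); split.
- by rewrite map_inj_in_uniq // => a b _ _ /(congr1 (fun t => t ^+ q)); rewrite !Hs.
- rewrite size_map insep_size; congr (_ * _)%N.
  by rewrite -(size_map_poly j) Ers size_scale // size_prod_XsubC.
- by move=> _ /mapP[r rin ->]; rewrite -insep_root Hs Rr.
Qed.

(* The powers [z ^+ i], [i < q], are independent over the field generated by
   [z ^+ q]; only the coefficient of [z ^+ 0] is needed. *)
Lemma insep_independent (A : 'I_q -> {poly k}) c (i0 : 'I_q) : i0 = 0%N :> nat ->
  j c = \sum_(i < q) (A i)^j.[z ^+ q] * z ^+ i -> (A i0)^j.[z ^+ q] = j c.
Proof.
move=> Ei0 Ec; have [mM Mz Mdiv] := HM.
have R0 : R != 0.
  by apply: contraNneq (is_minpoly_neq0 HM) => R0; rewrite EM R0 comp_poly0.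
have rR : R^j.[z ^+ q] = 0 by apply/rootP; rewrite insep_root.
(* Reduction modulo [R] keeps the degree of the relation [N] below that of [M], so [N] is zero. *)
pose B i := A i %% R.
have BE i : (B i)^j.[z ^+ q] = (A i)^j.[z ^+ q].
  by rewrite [in RHS](divp_eq (A i) R) rmorphD rmorphM !hornerE rR mulr0 add0r.
have sB i : (size (B i) <= (size R).-1)%N.
  by rewrite -ltnS prednK ?size_poly_gt0 // ltn_modp.
pose N := \sum_(i < q) 'X^i * (B i \Po 'X^q) - c%:P.
have Nz : root N^j z.
  rewrite rootE /N rmorphB hornerD hornerN /= map_polyC hornerC subr_eq0.
  apply/eqP/esym; apply: (etrans Ec); rewrite raddf_sum horner_sum; apply: eq_bigr => i _.
  rewrite /= rmorphM /= map_comp_poly !map_polyXn hornerM hornerXn horner_comp hornerXn.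
  by rewrite BE mulrC.
have sN : (size N < size M)%N.
  rewrite -[size M]prednK ?size_poly_gt0 ?(is_minpoly_neq0 HM) // ltnS insep_size.
  apply: leq_trans (size_polyD _ _) _; rewrite geq_max size_polyN; apply/andP; split.
    apply: leq_trans (size_sum _ _ _) _; apply/bigmax_leqP => i _.
    have [->|Bi] := eqVneq (B i) 0; first by rewrite comp_poly0 mulr0 size_poly0.
    have n0 : B i \Po 'X^q != 0 by rewrite comp_poly_eq0 // size_polyXn.
    rewrite size_monicM ?monicXn // size_polyXn addSn /=.
    rewrite -[size (_ \Po _)]prednK ?size_poly_gt0 // size_comp_poly size_polyXn /=.
    rewrite -addSnnS; apply: leq_trans (leq_add (ltn_ord i) (leqnn _)) _.
    by rewrite -mulSn prednK ?size_poly_gt0 // leq_mul2r sB orbT.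
  apply: leq_trans (size_polyC_leq1 _) _; rewrite muln_gt0 q0 andbT.
  exact: insep_size_gt1.
have N0 : N = 0.
  apply/eqP; apply: contraT => N0; have := dvdp_leq N0 (Mdiv _ Nz).
  by rewrite leqNgt sN.
suff EB : B i0 = c%:P by rewrite -BE EB map_polyC hornerC.
(* Coefficients at multiples of [q] see only the summand with exponent 0, since the other exponents
   are nonzero modulo [q]. *)
apply/polyP => l; have := congr1 (fun p : {poly k} => p`_(l * q)) N0.
rewrite /= coef0 coefB => /eqP; rewrite subr_eq0 coef_sum (bigD1 i0) //= big1 ?addr0.
  rewrite Ei0 expr0 mul1r coef_comp_poly_Xn // dvdn_mull // mulnK // => /eqP ->.
  by rewrite !coefC muln_eq0 [q == 0%N]gtn_eqF // orbF.
move=> i ni; rewrite coefXnM; case: ltnP => // le; rewrite coef_comp_poly_Xn //.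
rewrite dvdn_subr // ?dvdn_mull //; case: ifP => // /dvdn_leq.
have i1 : (0 < i)%N by rewrite lt0n -Ei0 (inj_eq val_inj).
by move/(_ i1); rewrite leqNgt ltn_ord.
Qed.

End InseparableDegree.


Lemma dvdp_prod_coprime_exp (F : fieldType) (P : {poly F}) (zs : seq F) q : uniq zs ->
  (forall z, z \in zs -> ('X - z%:P) ^+ q %| P) -> \prod_(z <- zs) ('X - z%:P) ^+ q %| P.
Proof.
elim: zs => [|z zs IH] /=; first by rewrite big_nil dvd1p.
move=> /andP[nz uz] H; rewrite big_cons Gauss_dvdp.
  rewrite H ?mem_head //=; apply: IH => // z' zin; apply: H.
  by rewrite inE zin orbT.
apply: coprimep_expl; rewrite coprimep_sym coprimep_XsubC.
rewrite prodrXl rootE horner_exp expf_eq0 negb_and.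
rewrite -rootE root_prod_XsubC nz orbT //.
Qed.

(** * Counting roots near the conjugates *)

Section CountingRoots.
Variables (K k : fieldType) (F : closedFieldType) (G : oagType).
Variables (iota : {rmorphism K -> F}) (j : {rmorphism k -> F}) (v : valuation F G).
Variables x y : F.
Local Notation "p ^iota" := (map_poly iota p) (at level 2, format "p ^iota").
Local Notation "p ^j" := (map_poly j p) (at level 2, format "p ^j").
Hypothesis no_max : forall c, exists c', v (x - iota c) < v (x - iota c').
Hypothesis conj_val_horner : forall M z z' (g : {poly k}),
  is_minpoly j M z -> root M^j z' -> v g^j.[z] = v g^j.[z'].
Hypotheses (iota_j : range iota `<=` range j) (y_j : range j y).
Variable M : {poly k}.
Hypothesis HM : is_minpoly j M x.

Lemma poly_range_iota (f : {poly K}) : exists r : {poly k}, f^iota = r^j.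
Proof. by apply: poly_range => i; apply: iota_j; rewrite coef_map; exists f`_i. Qed.

(** Expanded about [a], the polynomial f - y has constant and h-th coefficients with the same values
    as about x, by conjugacy. The constant term is then too small for all roots to stay at distance
    [v d] or less from [a]. *)
Lemma root_near_conjugate (f : {poly K}) h d a : (0 < h)%N -> root M^j a ->
  v (f^`N(h)^iota.[x] * d ^+ h) < v (y - f^iota.[x]) ->
  exists z, root (f^iota - y%:P) z /\ v d < v (z - a).
Proof.
move=> h0 Ma Hbig; pose P := f^iota - y%:P.
have [c _ Ec] := y_j; have [f1 Ef1] := poly_range_iota f.
have [fh Efh] := poly_range_iota f^`N(h).
have EP : P = (f1 - c%:P)^j by rewrite /P rmorphB /= map_polyC /= Ec Ef1.
have vP : v P.[a] = v (y - f^iota.[x]).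
  by rewrite EP -(conj_val_horner (f1 - c%:P) HM Ma) -EP /P !hornerE valB.
have vf : v f^`N(h)^iota.[a] = v f^`N(h)^iota.[x].
  by rewrite Efh -(conj_val_horner fh HM Ma).
pose S := P \Po ('X + a%:P); have [rs Ers] := closed_field_poly_normal S.
have [t [tin td]] : exists t, t \in rs /\ v d < v t.
  apply: contrapT => H.
  have : v S`_0 <= v (S`_h * d ^+ h).
    rewrite Ers !coefZ -mulrA; apply: le_valM2l; apply: val_coef0_prod_XsubC => t tin.
    by rewrite leNgt; apply/negP => td; apply: H; exists t.
  rewrite !coef_comp_XaddC nderivn0 vP /P nderivnB nderivnC gtn_eqF // subr0.
  rewrite nderivn_map valuationM vf -valuationM leNgt Hbig //.
exists (t + a); rewrite addrK; split=> //.
have : root S t by rewrite Ers rootE hornerZ (rootP (_ : root _ t)) ?mulr0 ?root_prod_XsubC.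
by rewrite !rootE horner_comp !hornerE.
Qed.

Lemma conjugates_le_dominant (g : {poly K}) q h d (xs : seq F) :
  let f := g \Po 'X^q in (0 < q)%N ->
  (forall a b : {poly F}, (a - b) ^+ q = a ^+ q - b ^+ q) ->
  dominant_index iota v x f h -> uniq xs -> (forall a, a \in xs -> root M^j a) ->
  (forall a b, a \in xs -> b \in xs -> a != b -> v (a - b) < v d) ->
  (forall c, v (x - iota c) < v d) ->
  v (f^`N(h)^iota.[x] * d ^+ h) < v (y - f^iota.[x]) ->
  (size xs * q <= h)%N.
Proof.
move=> f q0 frob Hh uxs Mxs xsd xd Hbig; have [/andP[h0 hn] Hdom] := Hh.
have fh0 := dominant_index_neq0 Hh.
pose P := f^iota - y%:P.
have /choice[s Hs] a : exists z, a \in xs -> root P z /\ v d < v (z - a).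
  case ain : (a \in xs); last by exists 0.
  have [z Hz] := root_near_conjugate h0 (Mxs _ ain) Hbig.
  by exists z => _.
(* A root shared by two conjugates would put them closer together than [v d] allows. *)
have us : uniq (map s xs).
  rewrite map_inj_in_uniq // => a b ain bin Eab; apply/eqP; apply: contraT => nab.
  have [_ Ha] := Hs a ain; have [_ Hb] := Hs b bin.
  have := xsd a b ain bin nab; rewrite ltNge => /negP[]; apply: ltW.
  have -> : a - b = (s b - b) - (s a - a) by rewrite Eab; ring.
  exact: lt_val_sub.
have dvdP z : root P z -> ('X - z%:P) ^+ q %| P.
  move=> Pz; rewrite frob -polyC_exp.
  have EP : P = (g^iota - y%:P) \Po 'X^q.
    by rewrite /P /f map_comp_poly map_polyXn comp_polyB comp_polyC.
  have /factor_theorem[u Eu] : root (g^iota - y%:P) (z ^+ q).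
    by move: Pz; rewrite EP !rootE horner_comp hornerXn.
  by rewrite EP Eu comp_polyM comp_polyB comp_polyX comp_polyC dvdp_mulIr.
have /dvdpP[B EB] : \prod_(z <- map s xs) ('X - z%:P) ^+ q %| P.
  apply: dvdp_prod_coprime_exp => // _ /mapP[a ain ->].
  by apply: dvdP; have [] := Hs a ain.
(* The roots are recentred at x and each is listed [q] times; the ball has radius [v r] for one c
   sufficiently near x. *)
pose rs := [seq s a - x | a <- xs, i <- seq.iota 0 q].
have [c Hc] := near_ex Hdom; pose r := x - iota c.
have r0 : r != 0 := sub_x_neq0 no_max c.
have PN i : (0 < i)%N -> P^`N(i).[x] = f^`N(i)^iota.[x].
  by move=> i0; rewrite /P nderivnB nderivnC gtn_eqF // subr0 nderivn_map.
have P0 : P != 0.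
  by apply: contraNneq fh0 => P0; rewrite -PN // P0 nderivn_poly0 ?size_poly0 ?horner0.
have B0 : B != 0 by apply: contraNneq P0 => B0; rewrite EB B0 mul0r.
have Eshift : \prod_(t <- rs) ('X - t%:P) * (B \Po ('X + x%:P)) = P \Po ('X + x%:P).
  rewrite EB comp_polyM mulrC; congr (_ * _); rewrite rmorph_prod /= big_map /rs.
  rewrite big_allpairs_dep; apply: eq_bigr => a _.
  rewrite big_const_seq count_predT size_iota iter_mulr_1.
  by rewrite rmorphXn /= comp_polyB comp_polyX comp_polyC polyCB; congr (_ ^+ _); ring.
have -> : (size xs * q)%N = size rs by rewrite size_allpairs size_iota.
apply: (@size_le_dominant_scaled _ _ v rs (B \Po ('X + x%:P)) h r r0).
- by rewrite comp_poly2_eq0 // size_XaddC.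
- move=> _ /allpairsP[[a i] /= [ain _ ->]].
  have [_ sa] := Hs a ain.
  have -> : s a - x = (s a - a) + (a - x) by ring.
  apply: le_val_add; first exact: ltW (lt_trans (xd c) sa).
  (* The conjugate a - c of x - c has the same value, so [a] lies in the ball of radius [v r] about
     x. *)
  have -> : a - x = (a - iota c) - r by rewrite /r; ring.
  apply: le_val_sub => //; rewrite /r.
  have [c' _ Ec] : range j (iota c) by apply: iota_j; exists c.
  have := conj_val_horner ('X - c'%:P) HM (Mxs a ain).
  by rewrite rmorphB /= map_polyX map_polyC /= !hornerE Ec => ->.
- rewrite Eshift => i hi; rewrite !coef_comp_XaddC.
  rewrite !PN ?(leq_trans _ hi) //.
  have [lei|lti] := leqP i (size f).-1.
    by apply: Hc; rewrite ?lei ?(leq_trans _ hi) // gtn_eqF.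
  rewrite [f^`N(i)]nderivn_poly0 ?rmorph0 ?horner0 ?mul0r.
    by rewrite val_lt0 mulf_neq0 // expf_neq0.
  by move: lti; case: (size f).
Qed.
End CountingRoots.


Lemma algebraic_horner (k F : fieldType) (j : {rmorphism k -> F}) (p : {poly k}) z :
  algebraicOver j z -> algebraicOver j (map_poly j p).[z].
Proof.
move=> az; elim/poly_ind: p => [|p c IH]; first by rewrite rmorph0 horner0; apply: algebraic0.
rewrite rmorphD rmorphM /= map_polyX map_polyC !hornerE /=.
by apply: algebraic_add; [apply: algebraic_mul | apply: algebraic_id].
Qed.

Lemma algebraic_over_larger (K k F : fieldType) (iota : {rmorphism K -> F})
    (j : {rmorphism k -> F}) x : range iota `<=` range j -> algebraicOver j x ->
  (forall z, algebraic_over (adjoin (range iota) x) z) -> forall z, algebraicOver j z.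
Proof.
move=> Kj ax alg z; have sKx := subfield_adjoin (range iota) x.
have [k1 [j1 E1]] := subfield_is_range sKx.
apply: (algebraic_trans (j1 := j1)); last exact: algebraicOver_range E1 (alg z).
move=> c; have : adjoin (range iota) x (j1 c) by rewrite E1; exists c.
have sub : adjoin (range iota) x `<=` adjoin (range j) x.
  apply: adjoin_sub; [exact: subfield_adjoin | | exact: mem_adjoin].
  by move=> a /Kj; apply: sub_adjoin.
move=> /sub; rewrite adjoin_algebraic // => -[p ->].
exact: algebraic_horner.
Qed.

Lemma val_above (F : fieldType) (G : oagType) (v : valuation F G) (zs : seq F) :
  (exists2 w, w != 0 & v 1 < v w) ->
  exists2 d, d != 0 & forall z, z \in zs -> z != 0 -> v z < v d.
Proof.
move=> [w w0 w1]; elim: zs => [|z zs [d d0 Hd]]; first by exists 1; rewrite ?oner_neq0.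
have [->|z0] := eqVneq z 0.
  by exists d => // t; rewrite inE => /predU1P[->|/Hd]; rewrite ?eqxx.
have [lt|le] := ltP (v z) (v d).
  by exists d => // t; rewrite inE => /predU1P[->|/Hd].
have lt : v z < v (z * w) by rewrite -{1}[z]mulr1 lt_val_pM2l.
exists (z * w); first by rewrite mulf_neq0.
move=> t; rewrite inE => /predU1P[->//|/Hd H t0].
exact: lt_trans (H t0) (le_lt_trans le lt).
Qed.

Section Distance.
Variables (K F : fieldType) (G : oagType) (iota : {rmorphism K -> F}).
Variables (v : valuation F G).

Lemma immediate_no_max x : immediate_appr iota v x ->
  forall c, exists c', v (x - iota c) < v (x - iota c').
Proof.
move=> imm c; apply: contrapT => H.
suff : (\bigcap_(a in appr_support iota v x) appr iota v x a) c by rewrite imm.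
move=> a [_ [c' /= Hc']]; rewrite /appr /=; apply: le_trans Hc' _.
by rewrite leNgt; apply/negP => lt; apply: H; exists c'.
Qed.

(** Without a best approximation, each v(y - c) is a value of vK in the support, and these values
    generate the lower cut set. *)
Lemma ge_distP y : (forall c, exists c', v (y - iota c) < v (y - iota c')) ->
  forall a, ge_dist iota v a y <-> forall c, v (y - iota c) <= a.
Proof.
move=> nomax a; split=> [H c|H].
  have [c' lt] := nomax c; have [g Eg] := val_fin v (val_neq0 lt).
  rewrite Eg; apply: H; apply: sub_gen_smallest; split.
    left; exists g => //; exists (iota (c' - c)); first by exists (c' - c).
    rewrite -Eg rmorphB (_ : iota c' - _ = (y - iota c) - (y - iota c')); last by ring.
    by rewrite val_subl.
  by exists c; rewrite /appr /= Eg.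
suff sub : dist_lower iota v y `<=` [set d | divisible_hull iota v d /\ Fin d <= a].
  by move=> g /sub[].
apply: smallest_sub => [|d [vd [c Hc]]].
  split=> [d []//|d e [Hd Hda] He ed]; split=> //.
  exact: le_trans (_ : Fin e <= Fin d) Hda.
split; last exact: le_trans Hc (H c).
by exists 1%N => //; case: vd => [[e He [<-]]|//].
Qed.
End Distance.


Theorem theorem10p7 (K : fieldType) (Omega : closedFieldType) (G : oagType)
    (iota : {rmorphism K -> Omega}) (v : valuation Omega G) (x y : Omega)
    (Omega_alg : forall z : Omega, algebraic_over (adjoin (range iota) x) z)
    (rank1_K : rank1 v (range iota))
    (imm_Kx : immediate_ext v (range iota) (adjoin (range iota) x))
    (x_notin_Kc : notin_completion iota v x)
    (x_trans : transcendental_appr iota v x)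
    (y_in : henselization v (adjoin (range iota) x) y)
    (y_trans : ~ algebraicOver iota y) :
  exists2 d : nat,
    has_degree (henselization v (adjoin (range iota) x))
               (henselization v (adjoin (range iota) y)) d
    & (d <= rel_approx_degree iota v x y)%N.
Proof.
have sK : subfield (range iota) := subfield_range iota.
have sKx := subfield_adjoin (range iota) x.
have [_ vKx _] := imm_Kx.
have arch := rank1_archimedean sK sKx vKx rank1_K Omega_alg.
have [w wK [w0 w1]] := rank1_nontrivial sK rank1_K.
have nontriv : exists2 w, w != 0 & v 1 < v w by exists w.
have [immx fixx] := x_trans.
have no_max := immediate_no_max immx.
have fixed f : exists a, near_elt iota v x (fun c => v (iota f.[c]) = a).
  by have [a [_ Ha]] := fixx f; exists a; apply/near_tends_to.
have [g g0 xg] : exists2 g, g != 0 & forall c, v (x - iota c) < v g.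
  have [b [e _ Ee] Hb] := x_notin_Kc; exists e; last by move=> c; rewrite Ee.
  by rewrite -(val_lt0 v) Ee valuation0.
pose L := henselization v (adjoin (range iota) x); rewrite -/L.
pose E := henselization v (adjoin (range iota) y); rewrite -/E.
have hL : henselian v L := henselian_henselization v _.
have hE : henselian v E := henselian_henselization v _.
have KxL : adjoin (range iota) x `<=` L := @sub_henselization _ _ v _.
have KyE : adjoin (range iota) y `<=` E := @sub_henselization _ _ v _.
have sL : subfield L by case: hL.
have sE : subfield E by case: hE.
have KL : range iota `<=` L := subset_trans (@sub_adjoin _ _ x) KxL.
have KE : range iota `<=` E := subset_trans (@sub_adjoin _ _ y) KyE.
have xL : L x by apply: KxL; apply: mem_adjoin.
have yE : E y by apply: KyE; apply: mem_adjoin.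
have sub_EL : E `<=` L.
  by apply: henselization_sub => //; apply: adjoin_sub.
have [k [j EE]] := subfield_is_range sE.
(* y is algebraic over K(x) but not over K, so the exchange property makes x algebraic over E. *)
have algx : algebraicOver j x.
  by apply: (algebraic_exchange (iota := iota) _ _ y_trans (Omega_alg y)); rewrite -EE.
have algE := algebraic_over_larger (eq_ind _ (fun S => _ `<=` S) KE _ EE) algx Omega_alg.
have nontriv_range k' (j' : {rmorphism k' -> Omega}) : range iota `<=` range j' ->
    exists2 w, range j' w & w != 0 /\ v 1 < v w.
  by move=> Kj'; exists w => //; apply: Kj'.
have Kj : range iota `<=` range j by rewrite -EE.
have hj : henselian v (range j) by rewrite -EE.
have hext := henselian_extension hj arch (nontriv_range _ _ Kj) algE.
have L_adjoin : L = adjoin (range j) x.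
  apply/seteqP; split; last by rewrite -EE; apply: adjoin_sub.
  apply: henselization_sub.
    by apply: hext; [exact: subfield_adjoin | exact: sub_adjoin].
  apply: adjoin_sub; [exact: subfield_adjoin | | exact: mem_adjoin].
  by move=> a Ka; apply: sub_adjoin; apply: Kj.
have [M HM] := minpoly_ex algx.
exists (size M).-1; first by rewrite L_adjoin EE; apply: minpoly_has_degree.
have [R [q [q0 EM R'0 frob]]] := inseparable_decomposition j (is_minpoly_size HM).
have [xs [uxs sxs Mxs]] := distinct_conjugates HM q0 EM R'0.
rewrite -sxs.
have [c Ec] : exists c, j c = y.
  by have : range j y by [rewrite -EE]; case=> c _ <-; exists c.
(* By [insep_independent], only the coefficient of [x ^+ 0] survives when y is
   expanded over [E'] in the powers [x ^+ i], [i < q]. *)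
pose E' := henselization v (adjoin (range iota) (x ^+ q)).
have yE' : E' y.
  have hE' : henselian v E' := henselian_henselization v _.
  have sE' : subfield E' by case: hE'.
  have KqE' : adjoin (range iota) (x ^+ q) `<=` E' := @sub_henselization _ _ v _.
  have KE' : range iota `<=` E' := subset_trans (@sub_adjoin _ _ _) KqE'.
  have [k' [j' EE']] := subfield_is_range sE'.
  have [c' Ec'] : exists c', j' c' = x ^+ q.
    have : range j' (x ^+ q) by rewrite -EE'; apply: KqE'; apply: mem_adjoin.
    by case=> c' _ <-; exists c'.
  have mXq : 'X^q - c'%:P \is monic by apply: monicXnsubC.
  have rXq : (map_poly j' ('X^q - c'%:P)).[x] = 0.
    by rewrite rmorphB /= map_polyXn map_polyC /= !hornerE Ec' subrr.
  have algx' : algebraicOver j' x.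
    by exists ('X^q - c'%:P); [exact: monic_neq0 | apply/rootP].
  have Kj' : range iota `<=` range j' by rewrite -EE'.
  have algE' := algebraic_over_larger Kj' algx' Omega_alg.
  have LE' : L `<=` adjoin (range j') x.
    apply: henselization_sub.
      apply: (henselian_extension _ arch (nontriv_range _ _ Kj') algE').
      - by rewrite -EE'.
      - exact: subfield_adjoin.
      - exact: sub_adjoin.
    apply: adjoin_sub; [exact: subfield_adjoin | | exact: mem_adjoin].
    by move=> a Ka; apply: sub_adjoin; apply: Kj'.
  have E'q : E' `<=` adjoin (range j) (x ^+ q).
    apply: henselization_sub.
      by apply: hext; [exact: subfield_adjoin | exact: sub_adjoin].
    apply: adjoin_sub; [exact: subfield_adjoin | | exact: mem_adjoin].
    by move=> a Ka; apply: sub_adjoin; apply: Kj.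
  have := LE' _ y_in; rewrite adjoin_algebraic // => -[p Ep].
  (* Since x^q lies in [E'], fewer than q + 1 coefficients suffice: y is a combination of x^i with i
     < q over [E']. *)
  pose p1 := p %% ('X^q - c'%:P).
  have Ep1 : y = (map_poly j' p1).[x].
    rewrite Ep [in LHS](divp_eq p ('X^q - c'%:P)) rmorphD rmorphM hornerD hornerM.
    by rewrite rXq mulr0 add0r.
  have sp1 : (size p1 <= q)%N.
    by rewrite -ltnS -(size_XnsubC c' q0) ltn_modp monic_neq0.
  have /choice[A HA] (i : 'I_q) : exists A, j' p1`_i = (map_poly j A).[x ^+ q].
    have : E' (j' p1`_i) by rewrite EE'; exists p1`_i.
    by move/E'q; rewrite adjoin_algebraic; [case=> A ->; exists A | apply: algE].
  have EcA : j c = \sum_(i < q) (map_poly j (A i)).[x ^+ q] * x ^+ i.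
    rewrite Ec Ep1 (@horner_coef_wide _ q) ?size_map_poly //.
    by apply: eq_bigr => i _; rewrite coef_map /=; congr (_ * _); apply: HA.
  have EA0 := insep_independent HM q0 EM (i0 := Ordinal q0) erefl EcA.
  by rewrite EE'; exists p1`_0 => //; rewrite -Ec -EA0; apply: (HA (Ordinal q0)).
have yj : range j y by rewrite -EE.
have y_notin c1 : y != iota c1.
  by apply/eqP => e; apply: y_trans; rewrite e; apply: algebraic_id.
(* y - c1 is a nonzero limit of K[x], so an element of K approximates it beyond its own value. *)
have y_no_max c1 : exists c2, v (y - iota c1) < v (y - iota c2).
  have yA : val_closure v (poly_values iota (map_poly iota 'X).[x]) y.
    by apply: henselization_closure => //; rewrite map_polyX hornerX.
  have [|c2 Hc2] := closure_approx no_max fixed nontriv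
    (closureB yA (@closure_const _ _ _ iota v x 'X c1)); first by rewrite subr_eq0.
  by exists (c1 + c2); rewrite rmorphD opprD addrA.
(* This says that y is not in K^c. Otherwise the closure of K is henselian and contains K(y), hence
   E and the coefficients of [M], which contradicts [not_root_monic] at x. *)
have [w2 w20 Hw2] : exists2 w2, w2 != 0 & forall c, v (y - iota c) < v w2.
  apply: contrapT => H.
  have E0 : poly_values iota (map_poly iota 0).[x] = range iota.
    rewrite rmorph0 horner0; apply/seteqP; split=> [a /poly_values0 //|_ [a _ <-]].
    by exists a%:P; rewrite map_polyC hornerC.
  have yA : val_closure v (range iota) y.
    move=> z z0; apply: contrapT => Hz; apply: H; exists z => // c1.
    by rewrite ltNge; apply/negP => le; apply: Hz; exists (iota c1) => //; exists c1.
  have sA : subfield (val_closure v (range iota)).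
    by rewrite -E0; apply: subfield_closure.
  have EA : E `<=` val_closure v (range iota).
    apply: henselization_sub.
      by apply: closed_subfield_henselian => //; apply: val_closure_closed.
    by apply: adjoin_sub => //; apply: sub_val_closure.
  have bnd : exists2 g, g != 0 & forall c, v (x - iota c) < v g by exists g.
  have [mM Mx _] := HM.
  apply: (not_root_monic no_max fixed nontriv bnd _ _ _ Mx).
  - by rewrite map_monic.
  - by rewrite size_map_poly (is_minpoly_size HM).
  - by move=> i; apply: EA; rewrite EE coef_map; exists M`_i.
have approx z : z != 0 -> exists p, v z <= v (y - (map_poly iota (p \Po 'X^q)).[x]).
  move=> z0.
  have yA : val_closure v (poly_values iota (map_poly iota 'X^q).[x]) y.
    by apply: henselization_closure => //; rewrite map_polyXn hornerXn.
  have [_ [p ->] Hp] := yA z z0; exists p.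
  by rewrite map_comp_poly horner_comp.
(* [f0] need not be a polynomial in X^q; such polynomials serve to show that a choice exists, and h
   is transferred from [f0] to one of them below. *)
rewrite /rel_approx_degree; set f0 := xget _ _.
have Hf0 c1 : v (y - iota c1) <= v (y - (map_poly iota f0).[x]).
  move: c1; apply/(ge_distP y_no_max).
  suff : [set f | ge_dist iota v (v (y - (map_poly iota f).[x])) y] f0 by [].
  apply: xgetPex; have [p Hp] := approx w2 w20.
  exists (p \Po 'X^q); apply/(ge_distP y_no_max) => c1.
  exact: le_trans (ltW (Hw2 c1)) Hp.
rewrite /rel_approx_degree_poly; set h := xget _ _.
have Hh : dominant_index iota v x f0 h.
  apply/(rel_approx_degree_dominant no_max fixed).
  suff : [set h | is_rel_approx_degree iota v x f0 h] h by [].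
  apply: xgetPex; have [h' Hh'] := dominant_index_poly_ex no_max
    (best_approx_size y_no_max Hf0).
  by exists h'; apply/(rel_approx_degree_dominant no_max fixed).
(* [d] lies above every v(x - c) and separates the conjugates; [W] lies above dist(y,K) and makes y
   - f(x) small enough for a root within [v d] of each conjugate. *)
have [d d0 Hd] := val_above (g :: [seq a - b | a <- xs, b <- xs]) nontriv.
have [W W0 HW] := val_above [:: w2; (map_poly iota f0^`N(h)).[x] * d ^+ h] nontriv.
have [p Hp] := approx W W0.
have Hf1 c1 : v (y - iota c1) <= v (y - (map_poly iota (p \Po 'X^q)).[x]).
  apply: le_trans (ltW (Hw2 c1)) _; apply: le_trans Hp; apply/ltW/HW => //.
  by rewrite mem_head.
have [Hh1 Eh1] := best_approx_dominant no_max fixed y_no_max Hf0 Hf1 Hh.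
apply: (conjugates_le_dominant no_max
  (conj_val_horner hj arch (nontriv_range _ _ Kj) algE) Kj yj HM q0 frob Hh1 uxs Mxs
  (d := d)).
- move=> a b ain bin nab; apply: Hd; last by rewrite subr_eq0.
  by rewrite inE; apply/orP; right; apply/allpairsP; exists (a, b).
- by move=> c1; apply: lt_trans (xg c1) _; apply: Hd; rewrite ?mem_head.
- apply: lt_le_trans Hp; rewrite valuationM Eh1 -valuationM; apply: HW.
    by rewrite !inE eqxx orbT.
  by rewrite mulf_neq0 ?expf_neq0 // (dominant_index_neq0 Hh).
Qed.
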